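(* Let $1\le s\le n$ and let $f_1(X)=0,\dots,f_s(X)=0$ be $s$ algebraic hypersurfaces without multiple factors in $\mathbb{C}^n$, of degrees $k_1,\dots,k_s$ respectively, which sufficiently intersect at the algebraic manifold $S=s(f_1,\dots,f_s)$. Let $m\ge 0$ be an integer. Then every $f(X)\in\mathbb{P}_m^{(n)}$ can be represented, using the monomials $\varphi_j(X)$, $j\in\bigcup_{t=0}^m T'_t(s)$, in the form $$f(X)=\sum_{t=0}^{m}\Big[\sum_{j\in T'_t(s)}a_j^{(t)}\varphi_j(X)+\sum_{j=1}^{s}c_j^{(t)}(X)f_j(X)\Big],$$ where $a_j^{(t)}\in\mathbb{C}$, the $c_j^{(t)}$ are polynomials, and $\deg\big(c_j^{(t)}(X)f_j(X)\big)=t$ whenever $c_j^{(t)}\neq 0$. Moreover, the dimension of the polynomial space $\mathbb{P}_m^{(n)}$ along $S$ is bounded above by $\sum_{j=0}^m h_j(s)$, where $h_j(s)$ denotes the coefficient of $t^j$ in the power series expansion of $(1-t^{k_1})\cdots(1-t^{k_s})(1-t)^{-n}$.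
   Context: $X=(x_1,\dots,x_n)$. $\mathbb{P}_m^{(n)}$ is the complex vector space of polynomials in $\mathbb{C}[x_1,\dots,x_n]$ of total degree $\le m$. For polynomials $f_1,\dots,f_s$, the algebraic manifold $S=s(f_1,\dots,f_s)$ is the set of common zeros of $f_1,\dots,f_s$ in $\mathbb{C}^n$. The dimension of $\mathbb{P}_m^{(n)}$ along $S$ is the dimension of the vector space of restrictions $\{f|_S: f\in\mathbb{P}_m^{(n)}\}$. A hypersurface $f(X)=0$ is without multiple factors if $f$ has no repeated non-constant factor. Sufficient intersection: let $k_1,\dots,k_s$ be nonnegative integers. The $s$ hypersurfaces $f_1=0,\dots,f_s=0$ of degrees $k_1,\dots,k_s$ in $\mathbb{C}^n$ ($1\le s\le n$) sufficiently intersect at $S=s(f_1,\dots,f_s)$ if there exist $n-s$ hypersurfaces $f_{s+1}=0,\dots,f_n=0$ of degrees $k_{s+1},\dots,k_n$ in $\mathbb{C}^n$ such that the $n$ hypersurfaces $f_1=0,\dots,f_n=0$ meet exactly at $k_1\cdots k_n$ mutually distinct points of $\mathbb{C}^n$. Index sets $T'_t(s)$: for each $i$ let $g_i$ be the sum of all monomial terms of degree $k_i$ of $f_i$, and let $\mathcal{B}=\langle g_1,\dots,g_s\rangle$. All $n$-variate monomials are listed as $\varphi_1,\varphi_2,\dots$ in order of nondecreasing total degree. For each $t\ge 0$, let $d_t(s)$ be the dimension of the space of homogeneous polynomials of degree $t$ in $\mathcal{B}$. The elementary items of degree $t$ are the polynomials $X^\alpha g_i$ with $|\alpha|+k_i=t$,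 $1\le i\le s$. Choose a maximal linearly independent subset of the elementary items of degree $t$ (it has $d_t(s)$ elements), and let $G_t$ be the matrix whose rows are the coefficient vectors of these chosen items with respect to the monomials of degree $t$ (columns are indexed by the monomials $\varphi_j$ of degree $t$). Select $d_t(s)$ linearly independent columns of $G_t$; the corresponding monomials of degree $t$ are called selected, and the remaining monomials of degree $t$ are called unselected. $T'_t(s)$ is the set of indices $j$ of the unselected monomials $\varphi_j$ of degree $t$.
   Formalization: In the definition of sufficient intersection the auxiliary hypersurfaces f_{s+1},...,f_n are required to have positive degree; if nonzero constants were allowed the bound fails (n=3, f_1=f_2=x_1, f_3=1, m=1). *)

(* Defs.v *)
From HB Require Import structures.
From mathcomp Require Import all_boot all_order all_algebra.
From mathcomp Require Export mpoly complex.
From mathcomp Require Import functions reals.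

Set Implicit Arguments.
Unset Strict Implicit.
Unset Printing Implicit Defensive.

Import Order.TTheory GRing.Theory Num.Theory.
Local Open Scope ring_scope.

(* Everything is defined over a field F; the theorem takes F := R[i] with
   R : realType, i.e. the complex numbers.  A polynomial p has degree k exactly
   when msize p = k.+1, and degree at most m (p = 0 included) exactly when
   msize p <= m.+1. *)

Section Dimension.
Variables (F : fieldType) (V : lmodType F).

Definition lin_indep (b : seq V) : Prop :=
  forall a : 'I_(size b) -> F,
    \sum_(i < size b) a i *: b`_i = 0 -> forall i, a i = 0.

(* V need not be finite dimensional, so vector.v does not apply: U has
   dimension d when it has a basis with d elements. *)
Definition has_dim (U : V -> Prop) (d : nat) : Prop :=
  exists b : seq V,
    [/\ size b = d,
        forall v, v \in b -> U v,
        lin_indep b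
      & forall v, U v ->
          exists a : 'I_(size b) -> F, v = \sum_(i < size b) a i *: b`_i].

Definition maximal_lin_indep (E : V -> Prop) (b : seq V) : Prop :=
  [/\ forall v, v \in b -> E v,
      lin_indep b
    & forall v, E v -> v \notin b -> ~ lin_indep (v :: b)].

Lemma has_dim_leq (U : V -> Prop) d d' :
  has_dim U d -> has_dim U d' -> (d <= d')%N.
Proof.
move=> [b [<- bU bI _]] [b' [<- _ _ b'S]].
have /fin_all_exists [A hA] (i : 'I_(size b)) :
    exists a : 'I_(size b') -> F, b`_i = \sum_(j < size b') a j *: b'`_j.
  by apply: b'S; apply: bU; rewrite mem_nth.
pose M := \matrix_(i < size b, j < size b') A i j.
suff /eqP <- : row_free M by apply: rank_leq_col.
rewrite -kermx_eq0; apply/rowV0P => u /sub_kermxP uM0.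
apply/rowP => i; rewrite mxE; apply: (bI (fun i => u 0 i)).
under eq_bigr => k _ do rewrite hA scaler_sumr.
rewrite exchange_big /= big1 // => j _.
under eq_bigr => k _ do rewrite scalerA.
rewrite -scaler_suml; have /rowP/(_ j) := uM0; rewrite !mxE => h.
suff -> : \sum_(l < size b) u 0 l * A l j = 0 by rewrite scale0r.
by rewrite -[RHS]h; apply: eq_bigr => l _; rewrite mxE.
Qed.

Lemma has_dim_uniq (U : V -> Prop) d d' : has_dim U d -> has_dim U d' -> d = d'.
Proof. by move=> h h'; apply/eqP; rewrite eqn_leq !(has_dim_leq (U := U)). Qed.

End Dimension.

Section Hypersurfaces.
Variables (F : fieldType) (n : nat).
Local Notation poly := {mpoly F[n]}.
Local Notation point := {ffun 'I_n -> F}.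

Definition without_multiple_factors (p : poly) : Prop :=
  forall q r : poly, p = q ^+ 2 * r -> (msize q <= 1)%N.

Definition zero_set (s : nat) (f : 'I_s -> poly) : pred point :=
  [pred x : point | [forall i, (f i).@[x] == 0]].

(* The auxiliary hypersurfaces have positive degree: with a nonzero constant
   among them every family would sufficiently intersect, the number of
   intersection points and the product of the degrees both being 0. *)
Definition sufficiently_intersect
    (s : nat) (k : 'I_s -> nat) (f : 'I_s -> poly) : Prop :=
  exists (k' : 'I_(n - s) -> nat) (f' : 'I_(n - s) -> poly),
    (forall i, (0 < k' i)%N /\ msize (f' i) = (k' i).+1) /\
    exists pts : seq point,
      [/\ uniq pts,
          size pts = ((\prod_(i < s) k i) * \prod_(i < n - s) k' i)%N
        & forall x, (x \in pts) = (x \in zero_set f) && (x \in zero_set f')].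

Definition restriction (S : pred point) (p : poly) : {x | x \in S} -> F^o :=
  fun x => p.@[val x].

Definition restrictions (m : nat) (S : pred point)
    (h : {x | x \in S} -> F^o) : Prop :=
  exists2 p : poly, (msize p <= m.+1)%N & h = restriction p.

End Hypersurfaces.

Section UnselectedMonomials.
Variables (F : fieldType) (n : nat).
Local Notation poly := {mpoly F[n]}.

(* A listing of all monomials in order of nondecreasing total degree (indexed
   from 0). *)
Definition graded_listing (phi : nat -> 'X_{1..n}) : Prop :=
  bijective phi /\ forall i j, (i <= j)%N -> (mdeg (phi i) <= mdeg (phi j))%N.

Section Selection.
Variables (phi : nat -> 'X_{1..n}) (s : nat).
Variables (k : 'I_s -> nat) (f : 'I_s -> poly).

Definition top_form (i : 'I_s) : poly := pihomog mdeg (k i) (f i).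

Definition top_ideal (p : poly) : Prop :=
  exists q : 'I_s -> poly, p = \sum_(i < s) q i * top_form i.

Definition top_ideal_part (t : nat) (p : poly) : Prop :=
  p \is t.-homog /\ top_ideal p.

Definition elementary_item (t : nat) (p : poly) : Prop :=
  exists (i : 'I_s) (mu : 'X_{1..n}),
    (mdeg mu + k i)%N = t /\ p = 'X_[mu] * top_form i.

Definition item_matrix (items : seq poly) (idx : seq nat) :
    'M[F]_(size items, size idx) :=
  \matrix_(r, c) (items`_r)@_(phi (nth 0%N idx c)).

(* The choices made in degree t: rows and columns of the matrix G_t.
   sel_dim is d_t(s), sel_idx the list of the indices of all the monomials of
   degree t; unselected below is T'_t(s). *)
Record selection (t : nat) := Selection {
  sel_dim : nat;
  sel_dimP : has_dim (top_ideal_part t) sel_dim;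
  sel_items : seq poly;
  sel_itemsP : maximal_lin_indep (elementary_item t) sel_items;
  sel_idx : seq nat;
  sel_idx_sorted : sorted ltn sel_idx;
  sel_idxP : forall j, (j \in sel_idx) = (mdeg (phi j) == t);
  sel_col : 'I_sel_dim -> 'I_(size sel_idx);
  sel_colP : row_free (colsub sel_col (item_matrix sel_items sel_idx))^T
}.

Definition unselected (t : nat) (C : selection t) : seq nat :=
  [seq nth 0%N (sel_idx C) l
     | l : 'I_(size (sel_idx C)) in [predC codom (@sel_col t C)]].

End Selection.
End UnselectedMonomials.

Section HilbertCoefficient.
Variables (n s : nat) (k : 'I_s -> nat).

(* The coefficient of t^j in (1 - t^k_1)...(1 - t^k_s) (1 - t)^(-n), where the
   series (1 - t)^(-1) = 1 + t + t^2 + ... may be truncated after t^j. *)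
Definition hilb_coef (j : nat) : int :=
  (\prod_(i < s) (1 - 'X^(k i)) * (\sum_(l < j.+1) 'X^l) ^+ n : {poly int})`_j.

Lemma coefM_congr (j : nat) (p q q' : {poly int}) :
  (forall i, (i <= j)%N -> q`_i = q'`_i) ->
  forall i, (i <= j)%N -> (p * q)`_i = (p * q')`_i.
Proof.
move=> h i ij; rewrite !coefM; apply: eq_bigr => l _; congr (_ * _).
by apply: h; apply: leq_trans (leq_subr _ _) ij.
Qed.

Lemma coefX_congr (j e : nat) (q q' : {poly int}) :
  (forall i, (i <= j)%N -> q`_i = q'`_i) ->
  forall i, (i <= j)%N -> (q ^+ e)`_i = (q' ^+ e)`_i.
Proof.
move=> h; elim: e => [|e IH] i ij; first by rewrite !expr0.
rewrite !exprS (coefM_congr (q' := q' ^+ e) _ IH) //.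
by rewrite mulrC (coefM_congr (q' := q') _ h) // mulrC.
Qed.

(* The series with coefficients hilb_coef times (1 - t)^n is the product of the
   1 - t^k_i, which characterizes it. *)
Lemma hilb_coefP (j : nat) :
  \sum_(l < j.+1) ((1 - 'X) ^+ n : {poly int})`_l * hilb_coef (j - l) =
  (\prod_(i < s) (1 - 'X^(k i)) : {poly int})`_j.
Proof.
set P := \prod_(i < s) _.
have coefG N i : (\sum_(l < N.+1) 'X^l : {poly int})`_i = (i <= N)%:R.
  rewrite coef_sum; under eq_bigr => l _ do rewrite coefXn.
  case: (leqP i N) => iN.
    rewrite (bigD1 (Ordinal (iN : (i < N.+1)%N))) //= eqxx big1 ?addr0 // => l.
    by rewrite -val_eqE /= eq_sym => /negbTE ->.
  rewrite big1 // => l _; case: eqP => // il.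
  by have := ltn_ord l; rewrite -il ltnS leqNgt iN.
pose G : {poly int} := \sum_(l < j.+1) 'X^l.
have -> : \sum_(l < j.+1) ((1 - 'X) ^+ n : {poly int})`_l * hilb_coef (j - l)
        = ((1 - 'X) ^+ n * (P * G ^+ n))`_j.
  rewrite coefM; apply: eq_bigr => l _; congr (_ * _).
  apply: (coefM_congr (j := (j - l)%N)) => //; apply: coefX_congr => i il.
  by rewrite !coefG il (leq_trans il) ?leq_subr.
have -> : (1 - 'X) ^+ n * (P * G ^+ n) = P * (1 - 'X^(j.+1)) ^+ n.
  rewrite mulrCA -exprMn; congr (_ * _ ^+ _).
  rewrite -[in RHS](expr1n _ j.+1) subrXX; congr (_ * _).
  by apply: eq_bigr => l _; rewrite expr1n mul1r.
rewrite -[in RHS](mulr1 P) -[in RHS](expr1n _ n).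
apply: (coefM_congr (j := j)) => //.
apply: coefX_congr => i ij.
by rewrite coefB coefXn ltn_eqF ?ltnS // subr0.
Qed.

End HilbertCoefficient.

(* Main.v *)
From HB Require Import structures.
Require Import Defs.
From mathcomp Require Import all_boot all_order all_algebra.
From mathcomp Require Import functions reals.
From mathcomp Require Import classical_sets cardinality boolp.
From mathcomp Require Import zify ring.
From mathcomp Require lebesgue_measure.

(** Let A be the polynomial ring, g_i the top form of f_i. In degree t the
    selected items span the ideal of the top forms, and the unselected monomials
    form a basis of A_t modulo that ideal, by the choice of an invertible
    submatrix ([unselected_quotient_basis]). Reducing the form of highest degree
    modulo the g_i and replacing g_i by f_i, which costs only terms of lower
    degree, gives the representation. Restricted to S it loses its multiples of
    the f_j, so the dimension along S is at most the number of unselected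
    monomials of degree at most m. It remains to see that there are h_t(s) of them
    in degree t, which holds when g_1, ..., g_s is a regular sequence: every step
    A / (g_1, ..., g_(i-1)) -> A / (g_1, ..., g_i) then multiplies the Hilbert
    series by 1 - t^(k_i) ([hilbert_function_regular]).

    Regularity comes from the sufficient intersection. Complete f_1, ..., f_s to n
    polynomials with exactly K = k_1 ... k_n distinct common zeros. The heart of
    the matter is that their top forms have no common zero except the origin
    ([no_zero_at_infinity]); this is a sharp form of the theorem of Bezout, proved
    by counting dimensions. Let e_1, ..., e_K be polynomials separating the common
    zeros. They are linearly independent over the ring generated by f_1, ..., f_n
    ([free_over_fibre]): at each common zero, which is isolated, the f_i are
    analytically independent, since otherwise the truncated local rings would be
    too small ([isolated_zero_no_relation]). So the products f^b e_l of degree at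
    most m are, asymptotically, as many as the monomials of degree at most m. If
    the top forms vanished at v <> 0, the degrees of all these products along the
    lines of direction v would stay below a fixed fraction of m, leaving out a
    subspace of positive density: a contradiction.

    By the Nullstellensatz, the ideal of the n top forms then contains a power of
    each variable. A sequence of n forms with that property is regular
    ([regular_finite_colength]): if a, b are forms such that a is regular modulo l
    and a power of a lies in (b, l), then b is regular modulo l, and regularity of
    sequences of forms does not depend on the order, so one passes from powers of
    the variables to the top forms by exchanging one form at a time, along a
    generic path on which all intermediate ideals have finite colength.

    The Nullstellensatz itself is elementary over an uncountable field: if every
    X_j - a had an inverse modulo an ideal, infinitely many of these inverses would
    have bounded degree, hence be linearly dependent, and clearing denominators in
    the relation would give a nonzero polynomial in X_j in the ideal
    ([poly_var_mem]). *)

Set Implicit Arguments.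
Unset Strict Implicit.
Unset Printing Implicit Defensive.

Import Order.TTheory GRing.Theory Num.Theory.
Local Open Scope ring_scope.

(** * Dimensions of spaces of polynomials *)

Section LinearAlgebra.
Variables (F : fieldType) (n : nat).
Implicit Types (p : {mpoly F[n]}) (mu : 'X_{1..n}).

(** More vectors than monomials: the coefficient matrix of the family has a nonzero left kernel. *)
Lemma mpoly_lin_dep (J : finType) (v : J -> {mpoly F[n]}) d :
    (forall j, (msize (v j) <= d)%N) -> (#|{: 'X_{1..n < d}}| < #|J|)%N ->
  exists2 c : J -> F, (exists j, c j != 0) & \sum_j c j *: v j = 0.
Proof.
move=> vd cJ.
pose M : 'M[F]_(#|J|, #|{: 'X_{1..n < d}}|) :=
  \matrix_(r, s) (v (enum_val r))@_(val (enum_val s : 'X_{1..n < d})).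
have /rowV0Pn [u /sub_kermxP uM u0] : kermx M != 0.
  by rewrite kermx_eq0 /row_free ltn_eqF // (leq_ltn_trans (rank_leq_col M)).
exists (fun j => u 0 (enum_rank j)).
  have [r ur] : exists r, u 0 r != 0.
    apply/existsP; apply: contraNT u0; rewrite negb_exists => /forallP h.
    by apply/eqP/rowP => r; rewrite mxE; apply/eqP; have := h r; rewrite negbK.
  by exists (enum_val r); rewrite enum_valK.
apply/mpolyP => mu; rewrite mcoeff0 raddf_sum /=.
case: (ltnP (mdeg mu) d) => mud; last first.
  rewrite big1 // => j _; rewrite mcoeffZ memN_msupp_eq0 ?mulr0 //.
  by apply: msize_mdeg_ge; apply: leq_trans mud.
have /rowP/(_ (enum_rank (BMultinom mud))) := uM; rewrite !mxE => h.
rewrite -[RHS]h [LHS](reindex (@enum_val _ J)) /=; last first.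
  by exists enum_rank => j _; rewrite ?enum_valK ?enum_rankK.
by apply: eq_bigr => r _; rewrite mcoeffZ enum_valK mxE enum_rankK.
Qed.

(** The truncations modulo degree [d] form a space of dimension the number of
    monomials of degree less than [d]; a family that spans it cannot be shorter. *)
Lemma mpoly_span_card (J : finType) (v : J -> {mpoly F[n]}) d :
    (forall p, exists a : J -> F, forall mu, (mdeg mu < d)%N ->
       p@_mu = (\sum_j a j *: v j)@_mu) ->
  (#|{: 'X_{1..n < d}}| <= #|J|)%N.
Proof.
move=> span.
have /fin_all_exists [a ha] (mu : 'X_{1..n < d}) := span 'X_[mu].
pose X : 'M[F]_(#|{: 'X_{1..n < d}}|, #|J|) :=
  \matrix_(r, s) a (enum_val r) (enum_val s).
pose Y : 'M[F]_(#|J|, #|{: 'X_{1..n < d}}|) :=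
  \matrix_(r, s) (v (enum_val r))@_(val (enum_val s : 'X_{1..n < d})).
have XY : X *m Y = 1%:M.
  apply/matrixP => r s; rewrite !mxE.
  have := ha (enum_val r) (enum_val s) (bmdeg _).
  rewrite mcoeffX -bmeqP (inj_eq enum_val_inj) => ->.
  rewrite raddf_sum /= [RHS](reindex (@enum_val _ J)) /=; last first.
    by exists enum_rank => j _; rewrite ?enum_valK ?enum_rankK.
  by apply: eq_bigr => j _; rewrite !mxE mcoeffZ.
rewrite -[leqLHS](mxrank1 F) -XY; apply: leq_trans (rank_leq_col X).
exact: mxrankM_maxl.
Qed.

End LinearAlgebra.

(** * Numbers of monomials *)

Lemma leq_exp_homo a b e : (a <= b -> a ^ e <= b ^ e)%N.
Proof. by move=> ab; elim: e => // e IH; rewrite !expnS leq_mul. Qed.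

Section Counting.
Variable n : nat.
Implicit Types (mu : 'X_{1..n}).

Lemma mnm_le_mdeg mu i : (mu i <= mdeg mu)%N.
Proof. by rewrite mdegE (bigD1 i) //= leq_addr. Qed.

Lemma card_bmnm_le d : (#|{: 'X_{1..n < d}}| <= d ^ n)%N.
Proof.
have lt (mu : 'X_{1..n < d}) i : (mu i < d)%N.
  exact: leq_ltn_trans (mnm_le_mdeg _ _) (bmdeg mu).
pose h (mu : 'X_{1..n < d}) : {ffun 'I_n -> 'I_d} := [ffun i => Ordinal (lt mu i)].
suff /leq_card : injective h by rewrite card_ffun !card_ord.
move=> mu nu /ffunP e; apply/val_inj/mnmP => i.
by have := e i; rewrite !ffunE => /(congr1 val).
Qed.

Lemma card_bmnm_ge q : (q.+1 ^ n <= #|{: 'X_{1..n < (n * q).+1}}|)%N.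
Proof.
have lt (h : {ffun 'I_n -> 'I_q.+1}) :
    (mdeg [multinom (h i : nat) | i < n] < (n * q).+1)%N.
  have -> : (n * q = \sum_(i < n) q)%N by rewrite sum_nat_const card_ord.
  by rewrite ltnS mdegE; apply: leq_sum => i _; rewrite mnmE -ltnS.
pose g (h : {ffun 'I_n -> 'I_q.+1}) := BMultinom (lt h).
suff /leq_card : injective g by rewrite card_ffun !card_ord.
move=> h h' /(congr1 val) /= /mnmP e; apply/ffunP => i; apply: val_inj.
by have := e i; rewrite !mnmE.
Qed.

Lemma card_bmnm_homo d e : (d <= e)%N ->
  (#|{: 'X_{1..n < d}}| <= #|{: 'X_{1..n < e}}|)%N.
Proof.
move=> de; pose h (mu : 'X_{1..n < d}) : 'X_{1..n < e} :=
  BMultinom (leq_trans (bmdeg mu) de).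
by apply: (@leq_card _ _ h) => mu nu /(congr1 val) /= /val_inj.
Qed.

(** Euclidean division of the exponents by the [k i] sends a monomial of degree at
    most [m] to a monomial of weighted degree at most [m], and each fibre injects
    into the product of the residue systems. *)
Lemma card_bmnm_ge_scaled (k : 'I_n -> nat) m : (forall i, 0 < k i)%N ->
  (#|{: 'X_{1..n < m.+1}}| <= (\prod_i k i) *
    #|[pred b : 'X_{1..n < m.+1} | \sum_i b i * k i <= m]|)%N.
Proof.
move=> k0.
rewrite -(card_sig (fun b : 'X_{1..n < m.+1} => (\sum_i b i * k i <= m)%N)).
have lt (mu : 'X_{1..n < m.+1}) :
    (\sum_i [multinom (mu i %/ k i)%N | i < n] i * k i <= m)%N.
  rewrite -ltnS; apply: leq_ltn_trans (bmdeg mu); rewrite mdegE leq_sum // => i _.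
  by rewrite mnmE leq_trunc_div.
have lt' (mu : 'X_{1..n < m.+1}) :
    (mdeg [multinom (mu i %/ k i)%N | i < n] < m.+1)%N.
  rewrite ltnS; apply: leq_trans (lt mu); rewrite mdegE leq_sum // => i _.
  by rewrite leq_pmulr.
pose quo (mu : 'X_{1..n < m.+1}) :
    {b : 'X_{1..n < m.+1} | (\sum_i b i * k i <= m)%N} :=
  exist (fun b : 'X_{1..n < m.+1} => (\sum_i b i * k i <= m)%N)
    (BMultinom (lt' mu)) (lt mu).
pose rem (mu : 'X_{1..n < m.+1}) : {dffun forall i, 'I_(k i)} :=
  [ffun i => Ordinal (ltn_pmod (mu i) (k0 i))].
have inj : injective (fun mu : 'X_{1..n < m.+1} => (rem mu, quo mu)).
  move=> mu nu e; apply/val_inj/mnmP => i.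
  have /ffunP/(_ i) := congr1 fst e; rewrite !ffunE => /(congr1 val) /= er.
  have /(congr1 (fun b => val (val b))) /= /mnmP/(_ i) := congr1 snd e.
  by rewrite !mnmE => eq; rewrite (divn_eq (mu i) (k i)) eq er -divn_eq.
have := leq_card _ inj; rewrite card_prod card_dep_ffun foldrE big_image /=.
by under eq_bigr => i _ do rewrite card_ord.
Qed.

End Counting.

(** A monomial that [b0] does not divide has an exponent smaller than that of
    [b0], so it is one of finitely many families with [n] free exponents: there are
    [O(d ^ n)] of them in [n.+1] variables, one order of magnitude fewer than all
    monomials. *)
Lemma card_bmnm_ndvd n (b0 : 'X_{1..n.+1}) d :
  (#|[pred b : 'X_{1..n.+1 < d} | ~~ (b0 <= b)%MM]|
     <= n.+1 * mdeg b0 * d ^ n)%N.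
Proof.
rewrite -(card_sig (fun b : 'X_{1..n.+1 < d} => ~~ (b0 <= b)%MM)).
pose T := ({b : 'X_{1..n.+1 < d} | ~~ (b0 <= b)%MM}); rewrite -/T.
have /fin_all_exists [j hj] (x : T) : exists j, (val (val x) j < b0 j)%N.
  case: x => x /= /mnm_lepP xb; apply: contra_notP xb => /forallNP h j.
  by have /negP := h j; rewrite -leqNgt.
have lt1 (x : T) : (val (val x) (j x) < mdeg b0)%N.
  exact: leq_trans (hj x) (mnm_le_mdeg _ _).
have lt2 (x : T) i : (val (val x) i < d)%N.
  exact: leq_ltn_trans (mnm_le_mdeg _ _) (bmdeg (val x)).
pose h (x : T) := (j x, Ordinal (lt1 x),
  [ffun i => Ordinal (lt2 x (lift (j x) i))] : {ffun 'I_n -> 'I_d}).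
have inj : injective h.
  move=> x y e; apply/val_inj/val_inj/mnmP => i.
  have ej : j x = j y := congr1 (fun z => z.1.1) e.
  have /(congr1 val) /= e1 := congr1 (fun z => z.1.2) e.
  have /ffunP e2 := congr1 snd e.
  have [<-|] := eqVneq (j x) i; first by rewrite e1 ej.
  move=> /unlift_some [l -> _].
  by have := e2 l; rewrite !ffunE => /(congr1 val) /=; rewrite -ej.
have := leq_card _ inj.
by rewrite !card_prod card_ffun !card_ord.
Qed.

(** * Ideals *)

Section Ideals.
Variable A : comNzRingType.
Implicit Types (P : A -> Prop) (p q g : A) (l : seq A).

Definition is_ideal P : Prop :=
  [/\ P 0, forall p q, P p -> P q -> P (p + q) & forall r p, P p -> P (r * p)].

Definition adjoin P g p : Prop := exists q, P (p - q * g).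

(** A recursion on the list, because regular sequences adjoin one generator at a
    time. *)
Fixpoint ideal_gen l p : Prop :=
  if l is g :: l' then adjoin (ideal_gen l') g p else p = 0.

Section Closure.
Variables (P : A -> Prop) (idP : is_ideal P).

Lemma ideal0 : P 0. Proof. by case: idP. Qed.
Lemma idealD p q : P p -> P q -> P (p + q). Proof. by case: idP => _ + _; apply. Qed.
Lemma idealMl r p : P p -> P (r * p). Proof. by case: idP => _ _; apply. Qed.
Lemma idealMr r p : P p -> P (p * r). Proof. by rewrite mulrC; apply: idealMl. Qed.
Lemma idealN p : P p -> P (- p). Proof. by rewrite -mulN1r; apply: idealMl. Qed.
Lemma idealB p q : P p -> P q -> P (p - q).
Proof. by move=> Pp /idealN; apply: idealD. Qed.
Lemma ideal_sum I (r : seq I) (Q : pred I) (f : I -> A) :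
  (forall i, Q i -> P (f i)) -> P (\sum_(i <- r | Q i) f i).
Proof. by move=> h; apply: big_ind => //; [apply: ideal0 | apply: idealD]. Qed.
Lemma ideal_eqmod p q : P (p - q) -> P p <-> P q.
Proof.
move=> h; split=> h'; first by rewrite -(subKr p q); apply: idealB.
by rewrite -(subrK q p); apply: idealD.
Qed.

Lemma adjoin_ideal g : is_ideal (adjoin P g).
Proof.
split.
- by exists 0; rewrite mul0r subr0; apply: ideal0.
- move=> p q [a ha] [b hb]; exists (a + b).
  by rewrite mulrDl opprD addrACA; apply: idealD.
- by move=> r p [a ha]; exists (r * a); rewrite -mulrA -mulrBr; apply: idealMl.
Qed.

Lemma sub_adjoin g p : P p -> adjoin P g p.
Proof. by exists 0; rewrite mul0r subr0. Qed.

Lemma mem_adjoin g : adjoin P g g.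
Proof. by exists 1; rewrite mul1r subrr; apply: ideal0. Qed.

End Closure.

Lemma ideal_gen_ideal l : is_ideal (ideal_gen l).
Proof.
elim: l => [|g l IH] /=; last exact: adjoin_ideal.
by split=> //= [p q -> ->|r p ->]; rewrite ?addr0 ?mulr0.
Qed.
Hint Resolve ideal_gen_ideal : core.

Lemma ideal_gen_mem l g : g \in l -> ideal_gen l g.
Proof.
elim: l => //= a l IH; rewrite inE => /predU1P [->|/IH]; first exact: mem_adjoin.
exact: sub_adjoin.
Qed.

Lemma ideal_gen_min P l : is_ideal P -> (forall g, g \in l -> P g) ->
  forall p, ideal_gen l p -> P p.
Proof.
move=> idP; elim: l => [|g l IH] lP p /=; first by move=> ->; apply: ideal0.
case=> q /IH h; rewrite -(subrK (q * g) p); apply: idealD => //.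
  by apply: h => x xl; apply: lP; rewrite inE xl orbT.
by apply: idealMl => //; apply: lP; rewrite mem_head.
Qed.

Lemma ideal_gen_sub l l' : (forall g, g \in l -> ideal_gen l' g) ->
  forall p, ideal_gen l p -> ideal_gen l' p.
Proof. exact: ideal_gen_min. Qed.

Lemma ideal_gen_subset l l' : {subset l <= l'} ->
  forall p, ideal_gen l p -> ideal_gen l' p.
Proof. by move=> s; apply: ideal_gen_sub => g /s; apply: ideal_gen_mem. Qed.

End Ideals.
#[global] Hint Resolve ideal_gen_ideal : core.

(** * The Nullstellensatz over an uncountable field *)

Section Nullstellensatz.
Variables (F : closedFieldType) (n : nat).
Hypothesis F_unc : ~ countable [set: F]%classic.
Implicit Types (P : {mpoly F[n]} -> Prop) (h : {poly F}).

Definition poly_var (j : 'I_n) h : {mpoly F[n]} := (map_poly (@mpolyC n F) h).['X_j].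

Lemma poly_var_prod j (I : eqType) (r : seq I) (Q : pred I) (c : I -> F) :
  poly_var j (\prod_(i <- r | Q i) ('X - (c i)%:P)) = \prod_(i <- r | Q i) ('X_j - (c i)%:MP).
Proof.
rewrite /poly_var rmorph_prod horner_prod; apply: eq_bigr => i _.
by rewrite rmorphB /= map_polyX map_polyC hornerD hornerN hornerX hornerC.
Qed.

Lemma poly_varZ j c h : poly_var j (c *: h) = c *: poly_var j h.
Proof. by rewrite /poly_var linearZ /= hornerZ mul_mpolyC. Qed.

Lemma poly_var_sum j I (r : seq I) (Q : pred I) (f : I -> {poly F}) :
  poly_var j (\sum_(i <- r | Q i) f i) = \sum_(i <- r | Q i) poly_var j (f i).
Proof. by rewrite /poly_var rmorph_sum horner_sum. Qed.

(** Otherwise [F] would be a countable union of finite sets. *)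
Lemma infinite_bounded_size (q : F -> {mpoly F[n]}) (E : seq F) :
  exists d, infinite_set [set a | a \notin E /\ (msize (q a) <= d)%N]%classic.
Proof.
apply: contrapT => /forallNP fin; apply: F_unc.
pose S d := [set a | a \notin E /\ (msize (q a) <= d)%N]%classic.
have -> : [set: F]%classic = ([set` E] `|` \bigcup_d S d)%classic.
  apply/seteqP; split=> // a _; have [aE|aE] := boolP (a \in E); first by left.
  by right; exists (msize (q a)).
rewrite -bigcup2E; apply: bigcup_countable => // -[|[|i]] _ /=.
- exact/finite_set_countable/finite_seq.
- apply: bigcup_countable => // d _; apply: finite_set_countable.
  by apply: contrapT; apply: fin.
- exact: countable0.
Qed.

(** If [q a] inverts ['X_j - a] modulo [P] for uncountably many [a], infinitely
    many of the [q a] have bounded degree, so finitely many of them satisfy a linear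
    relation with coefficients [c i]. Multiplying it by the product of all the
    ['X_j - a] turns it into a univariate polynomial in [P], which is nonzero because
    its value at the [i]-th point is a nonzero multiple of [c i]. *)
Lemma poly_var_mem P (j : 'I_n) (E : seq F) : is_ideal P ->
    (forall a, a \notin E -> adjoin P ('X_j - a%:MP) 1) ->
  exists2 h, h != 0 & P (poly_var j h).
Proof.
move=> idP hE.
have /choice [q hq] : forall a, exists q, a \notin E -> P (1 - q * ('X_j - a%:MP)).
  move=> a; have [/hE [q]|] := boolP (a \notin E); first by exists q.
  by exists 0.
have [d inf] := infinite_bounded_size q E.
have [B sB cB] := infinite_set_fset #|{: 'X_{1..n < d}}|.+1 inf.
set s := finmap.enum_fset B in cB.
have s_uniq : uniq s by exact: finmap.fset_uniq.
have sP i : (i < size s)%N -> s`_i \notin E /\ (msize (q (s`_i)%R) <= d)%N.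
  by move=> si; apply: (sB s`_i); rewrite /= mem_nth.
have [c [i0 ci0] cq] := @mpoly_lin_dep _ _ 'I_(size s) (fun i => q s`_i) d
  (fun i => (sP i (ltn_ord i)).2) (leq_trans cB (eq_leq (esym (card_ord _)))).
exists (\sum_i c i *: \prod_(l | l != i) ('X - (s`_l)%:P)).
  apply/eqP => /(congr1 (fun h : {poly F} => h.[s`_i0])).
  rewrite horner0 horner_sum (bigD1 i0) //= [X in _ + X]big1 ?addr0; last first.
    move=> i ii0; rewrite hornerZ horner_prod (bigD1 i0) 1?eq_sym //=.
    by rewrite hornerXsubC subrr mul0r mulr0.
  move=> /eqP; rewrite hornerZ mulf_eq0 (negbTE ci0) /= horner_prod.
  move/prodf_eq0 => [l li0]; rewrite hornerXsubC subr_eq0.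
  by rewrite nth_uniq // => /eqP/val_inj e; rewrite e eqxx in li0.
rewrite poly_var_sum.
under eq_bigr => i _ do rewrite poly_varZ poly_var_prod.
have -> : \sum_i c i *: \prod_(l | l != i) ('X_j - (s`_l)%:MP) =
  \sum_i (c i *: \prod_(l | l != i) ('X_j - (s`_l)%:MP)) *
      (1 - q s`_i * ('X_j - (s`_i)%:MP)).
  under [RHS]eq_bigr => i _ do rewrite mulrBr mulr1.
  rewrite sumrB -[LHS]subr0; congr (_ - _).
  rewrite -[LHS](mul0r (\prod_(l < size s) ('X_j - (s`_l)%:MP))) -[X in X * _]cq mulr_suml.
  apply: eq_bigr => i _; rewrite (bigD1 i) //= -!scalerAl; congr (_ *: _).
  by rewrite mulrA mulrC.
by apply: ideal_sum => // i _; apply: idealMl => //; apply: hq; case: (sP i).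
Qed.

(** If every ['X_j - a] were invertible modulo [P], so would be every product of
    them, that is every nonzero polynomial in ['X_j] since [F] is algebraically
    closed; but [P] contains such a polynomial. *)
Lemma adjoin_proper P (j : 'I_n) : is_ideal P -> ~ P 1 ->
  exists a, ~ adjoin P ('X_j - a%:MP) 1.
Proof.
move=> idP; apply: contra_notP => /forallNP hall.
have {}hall a : adjoin P ('X_j - a%:MP) 1 by apply: contrapT.
have [h h0] := @poly_var_mem P j [::] idP (fun a _ => hall a).
have [r hr] := closed_field_poly_normal h.
rewrite {1}hr poly_varZ poly_var_prod => Ph.
have {Ph} : P (\prod_(z <- r) ('X_j - z%:MP)).
  rewrite -[X in P X](scalerK (a := lead_coef h)) ?lead_coef_eq0 //.
  by rewrite -mul_mpolyC; apply: idealMl.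
elim: r {hr} => [|z r IH]; first by rewrite big_nil.
rewrite big_cons => hz; apply: IH; set w := \prod_(z <- r) _ in hz *.
have [q hq] := hall z; rewrite -[X in P X](subrK (q * ('X_j - z%:MP) * w)).
apply: idealD => //; last by rewrite -mulrA; apply: idealMl.
by rewrite -{1}[w]mul1r -mulrBl; apply: idealMr.
Qed.

(** Modulo the differences ['X_j - v j], a polynomial is its value at [v]. *)
Lemma ideal_at_point P (v : 'I_n -> F) : is_ideal P ->
  (forall j, P ('X_j - (v j)%:MP)) -> forall p, P (p - p.@[v]%:MP).
Proof.
move=> idP hv p.
have PM p1 p2 : P (p1 - p1.@[v]%:MP) -> P (p2 - p2.@[v]%:MP) ->
    P (p1 * p2 - (p1 * p2).@[v]%:MP).
  move=> h1 h2; rewrite mevalM mpolyCM.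
  have -> : p1 * p2 - p1.@[v]%:MP * p2.@[v]%:MP =
    p2 * (p1 - p1.@[v]%:MP) + p1.@[v]%:MP * (p2 - p2.@[v]%:MP).
    by rewrite !mulrBr addrA [p2 * _]mulrC [p2 * _]mulrC subrK.
  by apply: idealD => //; apply: idealMl.
have PC c : P (c%:MP - c%:MP.@[v]%:MP) by rewrite mevalC subrr; apply: ideal0.
rewrite [p]mpolyE (raddf_sum (meval v)) (raddf_sum (@mpolyC n F)) -sumrB; apply: ideal_sum => // m _ /=.
rewrite -mul_mpolyC; apply: (PM _ _ (PC _)); rewrite mpolyXE_id.
apply: (big_ind (fun x : {mpoly F[n]} => P (x - x.@[v]%:MP))) => //.
  by rewrite -mpolyC1.
move=> j _; elim: (m j) => [|e IH]; first by rewrite expr0 -mpolyC1.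
by rewrite exprS; apply: PM => //; rewrite mevalXU.
Qed.

(** Fix the coordinates of the zero one after the other with [adjoin_proper]. *)
Lemma nullstellensatz P : is_ideal P -> ~ P 1 ->
  exists v : 'I_n -> F, forall p, P p -> p.@[v] = 0.
Proof.
move=> idP P1.
have [Q [v [idQ Q1 PQ Qv]]] : exists Q (v : 'I_n -> F),
    [/\ is_ideal Q, ~ Q 1, forall p, P p -> Q p
      & forall j, j \in enum 'I_n -> Q ('X_j - (v j)%:MP)].
  elim: (enum 'I_n) => [|j l [Q [v [idQ Q1 PQ Qv]]]].
    by exists P, (fun=> 0).
  have [a ha] := @adjoin_proper Q j idQ Q1.
  exists (adjoin Q ('X_j - a%:MP)), (fun i => if i == j then a else v i).
  split=> //; [exact: adjoin_ideal | by move=> p /PQ; apply: sub_adjoin |].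
  move=> i; rewrite inE; case: eqP => [-> _|_ /= /Qv]; last exact: sub_adjoin.
  exact: mem_adjoin.
exists v => p /PQ Qp; apply/eqP; apply: contra_notT Q1 => pv0.
have Qc : Q p.@[v]%:MP.
  by apply/(ideal_eqmod idQ (ideal_at_point idQ _ p)) => // j; apply: Qv; rewrite mem_enum.
have -> : 1 = (p.@[v]^-1)%:MP * p.@[v]%:MP :> {mpoly F[n]}.
  by rewrite -mpolyCM mulVf.
exact: idealMl.
Qed.

End Nullstellensatz.

(** * Analytic independence at an isolated zero *)

Section Order.
Variables (F : fieldType) (n : nat).
Implicit Types (p q : {mpoly F[n]}).

(** Vanishing order at least [d] at the origin. *)
Definition order_ge d p := {in msupp p, forall m, (d <= mdeg m)%N}.

Lemma order_geM d e p q : order_ge d p -> order_ge e q -> order_ge (d + e) (p * q).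
Proof.
move=> hp hq m /msuppM_le /allpairsP [[m1 m2] /= [h1 h2 ->]].
by rewrite mdegD leq_add ?hp ?hq.
Qed.

Lemma order_ge1P p : p@_0%MM = 0 -> order_ge 1 p.
Proof.
move=> p0 m; rewrite lt0n mdeg_eq0; apply: contraL => /eqP ->.
by rewrite mcoeff_msupp p0 eqxx.
Qed.

Definition mprod (f : 'I_n -> {mpoly F[n]}) (b : 'X_{1..n}) := \prod_i f i ^+ b i.

Lemma mprodD f b c : mprod f (b + c) = mprod f b * mprod f c.
Proof. by rewrite -big_split /=; apply: eq_bigr => i _; rewrite mnmDE exprD. Qed.

Lemma mprod1 f i : mprod f U_(i) = f i.
Proof.
rewrite /mprod (bigD1 i) //= mnm1E eqxx expr1 big1 ?mulr1 // => j ji.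
by rewrite mnm1E eq_sym (negbTE ji) expr0.
Qed.

Lemma order_ge_mprod f b : (forall i, (f i)@_0%MM = 0) ->
  order_ge (mdeg b) (mprod f b).
Proof.
move=> f0; rewrite mdegE.
apply: (big_ind2 (fun d p => order_ge d p)) => //; first by move=> *; apply: order_geM.
move=> i _; elim: (b i) => [|e IH]; first by [].
by rewrite exprS -add1n; apply: order_geM => //; apply: order_ge1P.
Qed.

End Order.

Section IsolatedZero.
Variables (F : fieldType) (n' : nat).
Local Notation n := n'.+1.
Variables (f : 'I_n -> {mpoly F[n]}) (N : nat).
Hypothesis f0 : forall i, (f i)@_0%MM = 0.
Hypothesis isolated : forall j, exists u : {mpoly F[n]}, u@_0%MM = 1 /\
  exists c : 'I_n -> {mpoly F[n]}, u * 'X_j ^+ N = \sum_i c i * f i.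
Variables (b0 : 'X_{1..n}) (r : seq 'X_{1..n}) (w : 'X_{1..n} -> {mpoly F[n]}).
Hypothesis w0 : (w b0)@_0%MM = 1.
Hypothesis relation :
  w b0 * mprod f b0 = \sum_(b <- r | (b0 < b)%O) w b * mprod f b.

Section Span.
Variable d : nat.

Let J : finType := ({ffun 'I_n -> 'I_N} * {b : 'X_{1..n < d} | ~~ (b0 <= b)%MM})%type.
Let v (j : J) : {mpoly F[n]} :=
  'X_[[multinom (j.1 i : nat) | i < n]] * mprod f (val (val j.2)).

Let spanned (p : {mpoly F[n]}) : Prop := exists a : J -> F,
  forall mu, (mdeg mu < d)%N -> p@_mu = (\sum_j a j *: v j)@_mu.

Let spannedD p q : spanned p -> spanned q -> spanned (p + q).
Proof.
move=> [a ha] [b hb]; exists (fun j => a j + b j) => mu hmu.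
under eq_bigr => j _ do rewrite scalerDl.
by rewrite big_split /= !mcoeffD ha // hb.
Qed.

Let spannedZ c p : spanned p -> spanned (c *: p).
Proof.
move=> [a ha]; exists (fun j => c * a j) => mu hmu.
under eq_bigr => j _ do rewrite -scalerA.
by rewrite -scaler_sumr !mcoeffZ ha.
Qed.

Let spanned_order p : order_ge d p -> spanned p.
Proof.
move=> hp; exists (fun=> 0) => mu hmu; rewrite big1 ?mcoeff0; last first.
  by move=> j _; rewrite scale0r.
by apply: memN_msupp_eq0; apply: contraTN hmu => /hp; rewrite -leqNgt.
Qed.

Let spanned_sum I (s : seq I) (P : pred I) (g : I -> {mpoly F[n]}) :
  (forall i, P i -> spanned (g i)) -> spanned (\sum_(i <- s | P i) g i).
Proof. by apply: big_ind => //; apply: spanned_order => m; rewrite msupp0. Qed.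

Let spannedM q p : (forall m, m \in msupp q -> spanned ('X_[m] * p)) ->
  spanned (q * p).
Proof.
move=> h; rewrite {1}[q]mpolyE mulr_suml big_seq; apply: spanned_sum => m mq.
by rewrite -scalerAl; apply/spannedZ/h.
Qed.

Let spannedE q b : (forall g, spanned ('X_[g] * mprod f b)) ->
  spanned (q * mprod f b).
Proof. by move=> h; apply: spannedM. Qed.

(** Three rewriting rules reduce ['X_[g] * mprod f b] to the spanning family modulo
    order [d]: the relation, when [b0] divides [b]; the isolation of the zero, when
    an exponent of [g] is at least [N]; and the vanishing above order [d]. Each of
    the first two produces terms with a larger [b], or with the same [b] and a
    larger degree of [g], whence two nested descending inductions. *)
Let spanned_monomial b g : spanned ('X_[g] * mprod f b).
Proof.
have high e : (d <= mdeg e)%N -> forall q, spanned (q * mprod f e).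
  move=> de q; apply: spanned_order => m hm; apply: leq_trans de _.
  suff : order_ge (0 + mdeg e) (q * mprod f e) by apply.
  by apply: order_geM => //; apply: order_ge_mprod.
have [k] := ubnP #|[pred c : 'X_{1..n < d} | (b < c)%O]|.
elim: k b g => // k IHb b g hk.
case: (leqP d (mdeg b)) => bd; first exact: high.
have {IHb} H1 b1 : (b < b1)%O -> forall q, spanned (q * mprod f b1).
  move=> bb1 q; case: (leqP d (mdeg b1)) => b1d; first exact: high.
  apply: spannedE => g1; apply: IHb; rewrite ltnS in hk.
  apply: leq_trans hk; apply: proper_card; apply/properP; split.
    by apply/fintype.subsetP => c; rewrite !inE; apply: lt_trans.
  by exists (BMultinom b1d); rewrite !inE //= ltxx.
have [l] := ubnP (d - mdeg g); elim: l g => // l IHg g hl.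
case: (leqP d (mdeg g)) => gd.
  apply: spanned_order => m hm; apply: leq_trans gd _.
  suff : order_ge (mdeg g + 0) ('X_[g] * mprod f b).
    by move/(_ m hm); rewrite addn0.
  by apply: order_geM => // m'; rewrite msuppX inE => /eqP ->.
have {IHg} H2 q : order_ge 1 q -> spanned ('X_[g] * q * mprod f b).
  move=> hq; apply: spannedM => m hm; apply: IHg.
  suff : (mdeg g + 1 <= mdeg m)%N by lia.
  have : order_ge (mdeg g + 1) ('X_[g] * q); last by apply.
  by apply: order_geM => // m'; rewrite msuppX inE => /eqP ->.
have order1B (u : {mpoly F[n]}) : u@_0%MM = 1 -> order_ge 1 (1 - u).
  by move=> u1; apply: order_ge1P; rewrite mcoeffB mcoeff1 eqxx u1 subrr.
have split u : u@_0%MM = 1 -> spanned ('X_[g] * u * mprod f b) ->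
    spanned ('X_[g] * mprod f b).
  move=> u1 hu; rewrite -[X in spanned X](subrK ('X_[g] * u * mprod f b)).
  by apply: spannedD => //; rewrite -mulrBl -[X in X - _]mulr1 -mulrBr; auto.
(* The relation rewrites the factor [mprod f b0] into higher ones. *)
have [b0b|b0b] := boolP (b0 <= b)%MM.
  apply: (split _ w0); rewrite -(submK b0b) mprodD.
  rewrite -mulrA [w b0 * _]mulrCA relation !mulr_sumr; apply: spanned_sum => c bc.
  rewrite [mprod f _ * _]mulrCA -mprodD !mulrA; apply: H1.
  by rewrite -{1}(submK b0b) ltmc_add2r.
(* The isolation trades the [N]-th power of a variable for a factor [f i]. *)
have [/existsP [j Ngj]|] := boolP [exists j, (N <= g j)%N].
  have [u [u1 [c hc]]] := isolated j.
  apply: (split _ u1).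
  have Ug : (U_(j) *+ N <= g)%MM.
    apply/mnm_lepP => i; rewrite mulmnE mnm1E; case: eqP => [<-|_]; last by [].
    by rewrite mul1n.
  rewrite -(submK Ug) mpolyXD -mpolyXn -[_ * _ * u]mulrA [_ * u]mulrC hc.
  rewrite mulr_sumr mulr_suml; apply: spanned_sum => i _.
  rewrite -(mprod1 f i) mulrA -[_ * _ * mprod f b]mulrA -mprodD; apply: H1.
  by rewrite addmC -{1}[b]addm0 ltmc_add2r lt_mdeg_ltmc // mdeg0 mdeg1.
rewrite negb_exists => /forallP hN.
have lt i : (g i < N)%N by rewrite ltnNge.
pose j0 : J := ([ffun i => Ordinal (lt i)],
  exist (fun b : 'X_{1..n < d} => ~~ (b0 <= b)%MM) (BMultinom bd) b0b).
exists (fun j => (j == j0)%:R) => mu _; rewrite (bigD1 j0) //= big1; last first.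
  by move=> j /negbTE ->; rewrite scale0r.
rewrite eqxx scale1r addr0 /v /=; congr (_ * _)@__; congr 'X_[_].
by apply/mnmP => i; rewrite mnmE ffunE.
Qed.

(** The dimension of the truncations grows like [d ^ n], but the relation bounds it
    by [O(d ^ n')]. *)
Lemma truncation_spanned :
  (#|{: 'X_{1..n < d}}| <= N ^ n * (n * mdeg b0 * d ^ n'))%N.
Proof.
apply: leq_trans (mpoly_span_card (v := v) _) _.
  move=> p; rewrite -[p]mulr1; have <- : mprod f 0%MM = 1.
    by rewrite /mprod big1 // => i _; rewrite mnm0E expr0.
  exact: spannedE.
rewrite card_prod card_ffun !card_ord card_sig leq_mul2l.
by rewrite card_bmnm_ndvd orbT.
Qed.

End Span.

(** Equations with an isolated zero at the origin are analytically independent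
    there: a relation with a unit coefficient at its lowest monomial [b0] would make
    the dimension of the truncations modulo order [d] grow too slowly with [d]. *)
Lemma isolated_zero_no_relation : False.
Proof.
(* With [d = n * C + 1] the monomials number at least [C.+1 ^ n], and the bound
   of [truncation_spanned] is at most [C * C.+1 ^ n']. *)
pose C := (N ^ n * (n * mdeg b0) * n ^ n')%N.
have := leq_trans (card_bmnm_ge n C) (truncation_spanned (n * C).+1).
apply/negP; rewrite -ltnNge [X in (_ < X)%N]expnS.
apply: (@leq_ltn_trans (C * C.+1 ^ n')); last first.
  by rewrite ltn_mul2r expn_gt0 ltnSn.
apply: (@leq_trans (N ^ n * (n * mdeg b0) * (n * C.+1) ^ n')).
  by rewrite mulnA leq_mul2l leq_exp_homo ?orbT //; lia.
by rewrite expnMn mulnA.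
Qed.

End IsolatedZero.

(** * Independence over the subring generated by the equations *)

Section FamilyIdeal.
Variables (A : comNzRingType) (I : finType) (f : I -> A).

Definition fam_ideal (p : A) : Prop := exists c : I -> A, p = \sum_i c i * f i.

Lemma fam_ideal_ideal : is_ideal fam_ideal.
Proof.
split.
- by exists (fun=> 0); rewrite big1 // => i _; rewrite mul0r.
- move=> p q [a ->] [b ->]; exists (fun i => a i + b i).
  by rewrite -big_split; apply: eq_bigr => i _; rewrite mulrDl.
- move=> r p [a ->]; exists (fun i => r * a i).
  by rewrite mulr_sumr; apply: eq_bigr => i _; rewrite mulrA.
Qed.

Lemma fam_ideal_mem i : fam_ideal (f i).
Proof.
exists (fun j => (j == i)%:R); rewrite (bigD1 i) //= eqxx mul1r big1 ?addr0 // => j.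
by move=> /negbTE ->; rewrite mul0r.
Qed.

Lemma ideal_gen_fam p : ideal_gen (codom f) p <-> fam_ideal p.
Proof.
split; first apply: ideal_gen_min => [|g /codomP [i ->]].
- exact: fam_ideal_ideal.
- exact: fam_ideal_mem.
case=> c ->; apply: ideal_sum => // i _; apply: idealMl => //.
by apply: ideal_gen_mem; apply: codom_f.
Qed.

End FamilyIdeal.

Section EvalZero.
Variables (F : fieldType) (n : nat).
Implicit Types (p : {mpoly F[n]}) (x : 'I_n -> F).

Lemma meval_at0 p : p.@[fun=> 0] = p@_0%MM.
Proof.
rewrite [p in LHS]mpolyE raddf_sum /=.
have [p0|p0] := boolP (0%MM \in msupp p); last first.
  rewrite (memN_msupp_eq0 p0) big_seq big1 // => m mp; rewrite mevalZ mevalX.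
  have : m != 0%MM by apply: contraNneq p0 => <-.
  rewrite -mdeg_eq0 mdegE sum_nat_eq0 negb_forall => /existsP [i /= mi].
  by rewrite (bigD1 i) //= expr0n (negbTE mi) mul0r mulr0.
rewrite (bigD1_seq 0%MM) //= ?msupp_uniq // big1 => [|m].
  by rewrite addr0 mevalZ mpolyX0 meval1 mulr1.
rewrite -mdeg_eq0 mdegE sum_nat_eq0 negb_forall => /existsP [i /= mi].
by rewrite mevalZ mevalX (bigD1 i) //= expr0n (negbTE mi) mul0r mulr0.
Qed.

Definition translate x p : {mpoly F[n]} := p \mPo [tuple 'X_i + (x i)%:MP | i < n].

Lemma meval_translate x p y : (translate x p).@[y] = p.@[fun i => y i + x i].
Proof.
rewrite comp_mpoly_meval; apply: meval_eq => i.
by rewrite tnth_mktuple mevalD mevalXU mevalC.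
Qed.

Lemma mcoeff0_translate x p : (translate x p)@_0%MM = p.@[x].
Proof. by rewrite -meval_at0 meval_translate; apply: meval_eq => i; rewrite add0r. Qed.

Lemma translate_mprod x (f : 'I_n -> {mpoly F[n]}) b :
  translate x (mprod f b) = mprod (fun i => translate x (f i)) b.
Proof. by rewrite /translate rmorph_prod; apply: eq_bigr => i _; rewrite rmorphXn. Qed.

End EvalZero.

Section FiniteZeroSet.
Variables (F : closedFieldType) (n : nat).
Hypothesis F_unc : ~ countable [set: F]%classic.

Lemma poly_var_at0 j (h : {poly F}) : (poly_var j h : {mpoly F[n]})@_0%MM = h.[0].
Proof.
rewrite -meval_at0 /poly_var -horner_map /= mevalXU -map_poly_comp; congr (_.[_]).
by rewrite map_poly_id // => x _ /=; rewrite mevalC.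
Qed.


(** The ideal contains a nonzero polynomial in ['X_j] alone, since all but finitely
    many values of that coordinate are excluded; it factors as ['X_j ^+ N] times a
    polynomial that does not vanish at the origin. *)
Lemma finite_zeros_isolated (I : finType) (f : I -> {mpoly F[n]})
    (E : 'I_n -> seq F) :
    (forall x, (forall i, (f i).@[x] = 0) -> forall j, x j \in E j) ->
  exists N, forall j, exists u : {mpoly F[n]}, u@_0%MM = 1 /\
    fam_ideal f (u * 'X_j ^+ N).
Proof.
move=> hE; have idf := fam_ideal_ideal f.
have single j : exists N, exists u : {mpoly F[n]}, u@_0%MM = 1 /\
    fam_ideal f (u * 'X_j ^+ N).
  have [a aE|h h0 hf] := @poly_var_mem _ _ F_unc _ j (E j) idf.
    apply: contrapT => /(nullstellensatz F_unc (adjoin_ideal idf _)) [x hx].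
    have xf i : (f i).@[x] = 0.
      by apply: hx; apply: sub_adjoin; apply: fam_ideal_mem.
    have /eqP := hx _ (mem_adjoin idf ('X_j - a%:MP)).
    rewrite mevalB mevalXU mevalC subr_eq0 => /eqP xj.
    by move/negP: aE; apply; rewrite -xj; apply: hE.
  have [N [u]] := multiplicity_XsubC h 0; rewrite h0 /= => u0 hu.
  exists N, (u.[0]^-1 *: poly_var j u); split.
    by rewrite mcoeffZ poly_var_at0 mulVf.
  rewrite -scalerAl -mul_mpolyC; apply: idealMl => //.
  move: hf; rewrite hu /poly_var rmorphM rmorphXn hornerM horner_exp /=.
  by rewrite subr0 map_polyX hornerX.
have /fin_all_exists [N hN] := single.
exists (\sum_j N j)%N => j; have [u [u1 hu]] := hN j; exists u; split=> //.
by rewrite (bigD1 j) //= exprD mulrA; apply: idealMr.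
Qed.

End FiniteZeroSet.

Section AlgebraicIndependence.
Variables (F : closedFieldType) (n' : nat).
Local Notation n := n'.+1.
Hypothesis F_unc : ~ countable [set: F]%classic.
Variables (f : 'I_n -> {mpoly F[n]}) (E : 'I_n -> seq F).
Hypothesis fE : forall x, (forall i, (f i).@[x] = 0) -> forall j, x j \in E j.
Variables (K : finType) (pt : K -> 'I_n -> F) (e : K -> {mpoly F[n]}).
Hypothesis f_pt : forall l i, (f i).@[pt l] = 0.
Hypothesis e_pt : forall l l', ((e l).@[pt l'] == 0) = (l != l').

(** Take the lowest monomial [beta b0] with a nonzero coefficient [a l b0]. Near
    the point [pt l] only [e l] is invertible, so after translating that point to
    the origin the relation has a unit coefficient at its lowest monomial, which
    [isolated_zero_no_relation] forbids. *)
Lemma free_over_fibre (B : finType) (beta : B -> 'X_{1..n}) (a : K -> B -> F) :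
    injective beta ->
    \sum_l \sum_b a l b *: (mprod f (beta b) * e l) = 0 ->
  forall b l, a l b = 0.
Proof.
move=> beta_inj rel b0; have [c eqc] := ex_intro (eq^~ (beta b0)) _ erefl.
elim/(well_founded_ind (@ltom_wf n)): c b0 eqc => c IH b0 eqc l.
rewrite {c}eqc in IH.
apply/eqP; apply: contraT => alc; exfalso.
pose w b := \sum_l a l b *: e l.
have {}rel : w b0 * mprod f (beta b0) =
    - \sum_(b | (beta b0 < beta b)%O) w b * mprod f (beta b).
  apply/eqP; rewrite -addr_eq0 -[X in _ == X]rel exchange_big /=.
  have wE b : \sum_l a l b *: (mprod f (beta b) * e l) = w b * mprod f (beta b).
    by rewrite mulr_suml; apply: eq_bigr => i _; rewrite -scalerAl mulrC.
  under [X in _ == X]eq_bigr => b _ do rewrite wE.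
  apply/eqP; rewrite [RHS](bigD1 b0) //=; congr (_ + _).
  rewrite [RHS](bigID (fun b => (beta b0 < beta b)%O)) /=.
  rewrite [X in _ = _ + X]big1 ?addr0 => [|b].
    apply: eq_bigl => b; rewrite andb_idl // => cb.
    by apply: contraTneq cb => ->; rewrite ltxx.
  rewrite -leNgt le_eqVlt => /andP [+ /orP [/eqP/beta_inj e1|bc]].
    by rewrite e1 eqxx.
  move=> _; rewrite /w big1 ?mul0r // => i _.
  by rewrite (IH _ bc b erefl) scale0r.
pose x := pt l.
have wx : (w b0).@[x] = a l b0 * (e l).@[x].
  rewrite raddf_sum (bigD1 l) //= mevalZ big1 ?addr0 // => i il.
  have /eqP e0 : (e i).@[x] == 0 by rewrite e_pt.
  by rewrite mevalZ e0 mulr0.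
have wx0 : (w b0).@[x] != 0 by rewrite wx mulf_eq0 negb_or alc e_pt eqxx.
pose f' i := translate x (f i).
have [|N hN] := @finite_zeros_isolated F n F_unc _ f'
    (fun j => [seq z - x j | z <- E j]).
  move=> y hy j; rewrite -[y j](addrK (x j)); apply: map_f.
  by apply: (fE (x := fun j => y j + x j)) => i; rewrite -meval_translate; apply: hy.
pose k := (w b0).@[x]^-1.
pose ob c := [pick b | beta b == c].
have obK b : ob (beta b) = Some b.
  by rewrite /ob; case: pickP => [b' /eqP/beta_inj -> //|/(_ b)]; rewrite eqxx.
pose W c := (if c == beta b0 then k else - k) *: translate x (oapp w 0 (ob c)).
apply: (@isolated_zero_no_relation F n' f' N _ hN (beta b0) (codom beta) W).
- by move=> i; rewrite mcoeff0_translate f_pt.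
- by rewrite /W eqxx obK mcoeffZ mcoeff0_translate mulVf.
rewrite /W eqxx obK -translate_mprod -scalerAl -rmorphM /= rel rmorphN /= scalerN -scaleNr.
rewrite rmorph_sum scaler_sumr [RHS]big_image_cond; apply: eq_bigr => b cb /=.
by rewrite (gt_eqF cb) obK -scalerAl -translate_mprod -rmorphM.
Qed.

End AlgebraicIndependence.

(** * Degrees along parallel lines *)

Section LineSubstitution.
Variables (F : fieldType) (n : nat) (v : 'I_n -> F).
Implicit Types (p q : {mpoly F[n]}) (P Q : {poly {mpoly F[n]}}).

(** The polynomial [p (x + T v)] in the variable [T]: its degree in [T] is at most
    the degree of [p], and smaller when the top form of [p] vanishes at [v]. *)
Definition line_subst : {mpoly F[n]} -> {poly {mpoly F[n]}} :=
  mmap (polyC \o @mpolyC n F) (fun i => ('X_i)%:P + (v i)%:MP *: 'X).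
HB.instance Definition _ := GRing.RMorphism.on line_subst.

Lemma line_substX m : line_subst 'X_[m] = \prod_i (('X_i)%:P + (v i)%:MP *: 'X) ^+ m i.
Proof. exact: mmapX. Qed.

Lemma line_substZ c p : line_subst (c *: p) = c%:MP *: line_subst p.
Proof. by rewrite /line_subst mmapZ /= mul_polyC. Qed.

Lemma line_subst_at0 p : (line_subst p).[0] = p.
Proof.
rewrite [p in LHS]mpolyE [RHS]mpolyE rmorph_sum horner_sum; apply: eq_bigr => m _ /=.
rewrite line_substZ hornerZ mul_mpolyC line_substX horner_prod; congr (_ *: _).
rewrite mpolyXE_id; apply: eq_bigr => i _; rewrite horner_exp.
by rewrite hornerD hornerZ hornerC hornerX mulr0 addr0.
Qed.

Lemma line_subst_eq0 p : (line_subst p == 0) = (p == 0).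
Proof.
by apply/eqP/eqP => [h|->]; [rewrite -[p]line_subst_at0 h horner0 | rewrite rmorph0].
Qed.

(** [P] has degree at most [d] and [d]-th coefficient [c]; unlike the degree, this
    is multiplicative without exceptions. *)
Definition topped d (c : F) P := (size P <= d.+1)%N /\ P`_d = c%:MP.

Lemma toppedM d e c c' P Q : topped d c P -> topped e c' Q ->
  topped (d + e) (c * c') (P * Q).
Proof.
move=> [sP cP] [sQ cQ]; split.
  by apply: leq_trans (size_polyMleq _ _) _; lia.
have lt : (d < (d + e).+1)%N by rewrite ltnS leq_addr.
rewrite coefM (bigD1 (Ordinal lt)) //= addKn cP cQ big1 ?addr0 ?mpolyCM //.
move=> i; rewrite -val_eqE /= => id; have [di|di] := ltnP d i.
  by rewrite (nth_default _ (leq_trans sP di)) mul0r.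
by rewrite [Q`__]nth_default ?mulr0 //; apply: leq_trans sQ _; lia.
Qed.

Lemma topped_line_substX m : topped (mdeg m) (\prod_i v i ^+ m i) (line_subst 'X_[m]).
Proof.
rewrite line_substX mdegE.
pose T (dc : nat * F) P := topped dc.1 dc.2 P.
suff : T ((\sum_i m i)%N, \prod_i v i ^+ m i) (\prod_i (('X_i)%:P + (v i)%:MP *: 'X) ^+ m i) by [].
have T1 : T (0%N, 1) 1 by split; rewrite /= ?size_poly1 // coef1 mpolyC1.
elim: (index_enum _) => [|i r IH]; first by rewrite !big_nil.
rewrite !big_cons; apply: toppedM IH.
elim: (m i) => [|e IH] //; rewrite -add1n !exprS; apply: toppedM IH; split.
  apply: leq_trans (size_polyD _ _) _; rewrite geq_max size_polyC.
  by apply/andP; split; [case: eqP | rewrite (leq_trans (size_scale_leq _ _)) ?size_polyX].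
by rewrite coefD coefC coefZ coefX mulr1 add0r.
Qed.

Lemma topped_line_subst d p : (msize p <= d.+1)%N ->
  topped d (pihomog mdeg d p).@[v] (line_subst p).
Proof.
move=> pd.
have -> : line_subst p = \sum_(m <- msupp p) (p@_m)%:MP *: line_subst 'X_[m].
  rewrite {1}[p]mpolyE rmorph_sum; apply: eq_bigr => m _ /=.
  exact: line_substZ.
have -> : (pihomog mdeg d p).@[v] =
    \sum_(m <- msupp p) if mdeg m == d then p@_m * \prod_i v i ^+ m i else 0.
  rewrite pihomogE raddf_sum /= big_mkcond; apply: eq_bigr => m _ /=.
  by case: ifP => _ //=; rewrite mevalZ mevalX.
pose T c P := topped d c P.
rewrite big_seq [X in topped _ _ X]big_seq.
apply: (big_ind2 T) => [|c P c' Q [sP cP] [sQ cQ]|m mp]; rewrite /T.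
- by split; rewrite ?size_poly0 // coef0 mpolyC0.
- split; last by rewrite coefD cP cQ mpolyCD.
  by apply: leq_trans (size_polyD _ _) _; rewrite geq_max sP sQ.
have [s c] := topped_line_substX m.
have md : (mdeg m <= d)%N by rewrite -ltnS (leq_trans (msize_mdeg_lt mp)).
case: eqP => [<-|/eqP ne]; split.
- exact: leq_trans (size_scale_leq _ _) s.
- by rewrite coefZ c mpolyCM.
- by apply: leq_trans (size_scale_leq _ _) (leq_trans s _).
- rewrite coefZ nth_default ?mulr0 ?mpolyC0 //; apply: leq_trans s _.
  by rewrite ltn_neqAle ne.
Qed.

Lemma size_line_subst_le d p : (msize p <= d.+1)%N -> (size (line_subst p) <= d.+1)%N.
Proof. by case/topped_line_subst. Qed.

Lemma size_line_subst_lt d p : (msize p <= d.+1)%N ->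
  (pihomog mdeg d p).@[v] = 0 -> (size (line_subst p) <= d)%N.
Proof.
move=> /topped_line_subst [s c] g0; rewrite g0 mpolyC0 in c.
apply/leq_sizeP => j; rewrite leq_eqVlt => /orP [/eqP <- //|dj].
by rewrite nth_default // (leq_trans s).
Qed.

(** As [v j] is nonzero, ['X_j] has degree one along the lines of direction [v], and
    degrees add up. *)
Lemma line_subst_growth j r q : v j != 0 -> q != 0 ->
  (r < size (line_subst ('X_j ^+ r * q)))%N.
Proof.
move=> vj q0; rewrite rmorphM rmorphXn /=.
have Xj : size (line_subst 'X_j) = 2%N.
  rewrite line_substX (bigD1 j) //= mnm1E eqxx expr1 big1 ?mulr1 => [|i ij].
    rewrite addrC size_polyDl size_scale ?mpolyC_eq0 // size_polyX //.
    by rewrite size_polyC; case: eqP.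
  by rewrite mnm1E eq_sym (negbTE ij) expr0.
have lq : line_subst q != 0 by rewrite line_subst_eq0.
have lX : line_subst 'X_j ^+ r != 0 by rewrite expf_neq0 -?size_poly_gt0 ?Xj.
have sX : size (line_subst 'X_j ^+ r) = r.+1.
  by rewrite -[LHS]prednK ?size_poly_gt0 ?lX // size_exp Xj mul1n.
rewrite (size_mul lX lq) sX addSn /= -[X in (X < _)%N]addn0 ltn_add2l.
by rewrite size_poly_gt0.
Qed.

End LineSubstitution.

(** * Absence of zeros at infinity *)

(** Adding up these inequalities along an arithmetic progression of [t] terms bounds
    the number of monomials of degree [O(t)] from below by a multiple of
    [t * t ^ n], but it is only [O(t ^ n)]. *)
Lemma card_bmnm_growth n k M : (0 < M)%N ->
  ~ (forall q, (M < q)%N ->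
       #|{: 'X_{1..n < (k * q - M).+1}}| + #|{: 'X_{1..n < q - M}}|
         <= #|{: 'X_{1..n < (k * q).+1}}|)%N.
Proof.
move=> M0 step.
have [k0|k0] := posnP k.
  have := step M.+1 (leqnn _); rewrite k0 !mul0n sub0n subSnn -[X in (_ <= X)%N]addn0.
  rewrite leq_add2l leqn0 => /eqP c0.
  have := card_bmnm_ge n 0; rewrite muln0 exp1n c0 //.
pose a q := #|{: 'X_{1..n < (k * q).+1}}|.
have sum q0 t : (0 < q0)%N -> (t * #|{: 'X_{1..n < q0}}| <= a (q0 + t * M))%N.
  move=> q0_gt0; elim: t => // t IH.
  have lt : (M < q0 + t.+1 * M)%N by rewrite mulSn; lia.
  have sub : (q0 + t.+1 * M - M = q0 + t * M)%N by rewrite mulSn; lia.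
  apply: leq_trans (step _ lt); rewrite sub mulSn addnC leq_add //; last first.
    by apply: card_bmnm_homo; rewrite leq_addr.
  apply: leq_trans IH _; apply: card_bmnm_homo; rewrite ltnS mulSn.
  have := leq_mul k0 (leqnn M); rewrite mul1n => kM.
  by rewrite !mulnDr; lia.
(* The sum has [y.+1] terms and starts at degree [(n * y).+1], where there are at
   least [y.+1 ^ n] monomials; all degrees stay below [C * y.+1]. *)
pose C := (k * (n + M + 1) + 1)%N; pose y := (C ^ n)%N.
have arith z : ((n * z).+1 + z.+1 * M <= (n + M + 1) * z.+1)%N by nia.
have := sum (n * y).+1 y.+1 isT.
apply/negP; rewrite -ltnNge.
apply: (@leq_ltn_trans ((C * y.+1) ^ n)).
  apply: leq_trans (card_bmnm_le _ _) _; apply: leq_exp_homo.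
  rewrite /C mulnDl mul1n -addn1 leq_add // -mulnA leq_mul2l; apply/orP; right.
  exact: arith.
rewrite expnMn; apply: (@leq_trans (y.+1 * y.+1 ^ n)); last first.
  by rewrite leq_mul2l card_bmnm_ge orbT.
by rewrite ltn_mul2r expn_gt0 ltnSn.
Qed.

Lemma msizeM_leS (F : fieldType) n d e (p q : {mpoly F[n]}) :
  (msize p <= d.+1 -> msize q <= e.+1 -> msize (p * q) <= (d + e).+1)%N.
Proof.
have [->|p0] := eqVneq p 0; first by rewrite mul0r msize0.
have [->|q0] := eqVneq q 0; first by rewrite mulr0 msize0.
rewrite msizeM //; move: (msize p) (msize q) => a b; lia.
Qed.

Section NoZeroAtInfinity.
Variables (F : closedFieldType) (n' : nat).
Local Notation n := n'.+1.
Hypothesis F_unc : ~ countable [set: F]%classic.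
Variables (f : 'I_n -> {mpoly F[n]}) (k : 'I_n -> nat) (E : 'I_n -> seq F).
Hypothesis k_gt0 : forall i, (0 < k i)%N.
Hypothesis f_deg : forall i, msize (f i) = (k i).+1.
Hypothesis fE : forall x, (forall i, (f i).@[x] = 0) -> forall j, x j \in E j.
Variables (K : finType) (pt : K -> 'I_n -> F) (e : K -> {mpoly F[n]}).
Hypothesis f_pt : forall l i, (f i).@[pt l] = 0.
Hypothesis e_pt : forall l l', ((e l).@[pt l'] == 0) = (l != l').
Hypothesis cardK : #|K| = (\prod_i k i)%N.

Lemma msize_mprod_le (b : 'X_{1..n}) : (msize (mprod f b) <= (\sum_i b i * k i).+1)%N.
Proof.
apply: (big_ind2 (fun (d : nat) (p : {mpoly F[n]}) => msize p <= d.+1)%N).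
- by rewrite msize1.
- by move=> *; apply: msizeM_leS.
move=> i _; elim: (b i) => [|c IH]; first by rewrite msize1.
by rewrite exprS mulSn; apply: msizeM_leS; rewrite ?f_deg.
Qed.

Lemma size_line_subst_mprod_le (v : 'I_n -> F) (b : 'X_{1..n}) :
    (forall i, (pihomog mdeg (k i) (f i)).@[v] = 0) ->
  (size (line_subst v (mprod f b)) <= (\sum_i b i * (k i).-1).+1)%N.
Proof.
move=> gv; rewrite rmorph_prod.
have szM d c (p q : {poly {mpoly F[n]}}) :
    (size p <= d.+1 -> size q <= c.+1 -> size (p * q)%R <= (d + c).+1)%N.
  by move=> hp hq; apply: leq_trans (size_polyMleq _ _) _; lia.
apply: (big_ind2 (fun (d : nat) (p : {poly {mpoly F[n]}}) => size p <= d.+1)%N).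
- by rewrite size_poly1.
- by move=> *; apply: szM.
move=> i _; rewrite rmorphXn /=; elim: (b i) => [|c IH]; first by rewrite size_poly1.
rewrite exprS mulSn; apply: szM => //; rewrite prednK //.
by apply: size_line_subst_lt => //; rewrite f_deg.
Qed.

(** Suppose the top forms vanish at [v], with [v j] nonzero. The products of the
    [mprod f b] with the [e l] are independent by [free_over_fibre]; in degree at
    most [m] there are asymptotically as many of them as monomials, because [#|K|]
    is the product of the [k i]. But along the lines of direction [v] their degree is
    at most [(1 - 1 / kap) m], up to a constant, so they are also independent of the
    multiples of a power of ['X_j] beyond that bound, and there is no room left for
    these. *)
Lemma no_zero_at_infinity_succ (v : 'I_n -> F) :
  (forall i, (pihomog mdeg (k i) (f i)).@[v] = 0) -> forall j, v j = 0.
Proof.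
move=> gv j; apply/eqP; apply: contraT => vj; exfalso.
have [kap k_le] : exists kap, forall i, (k i <= kap)%N.
  by exists (\sum_i k i)%N => i; rewrite (bigD1 i) //= leq_addr.
have [M [M0 e_le]] : exists M, (0 < M)%N /\ forall l, (msize (e l) <= M)%N.
  by exists (\sum_l msize (e l)).+1; split=> // l; rewrite (bigD1 l) //= ltnW // ltnS leq_addr.
apply: (@card_bmnm_growth n kap M M0) => q Mq.
(* Degrees are at most [kap * q]; the margin [M] absorbs the degrees of the [e l]. *)
set D := (kap * q - M)%N.
apply: leq_trans (leq_add (card_bmnm_ge_scaled D k_gt0) (leqnn _)) _.
rewrite -cardK leqNgt; apply/negP => big.
pose wt (b : 'X_{1..n < D.+1}) := (\sum_i b i * k i <= D)%N.
pose r := ((kap - 1) * q + M)%N.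
pose J : finType := (K * {b | wt b} + 'X_{1..n < q - M})%type.
pose V (x : J) := match x with
  | inl lb => mprod f (val (val lb.2)) * e lb.1
  | inr a => 'X_j ^+ r.+1 * 'X_[val a] end.
have kap0 : (0 < kap)%N by apply: leq_trans (k_gt0 j) (k_le j).
have kq : (kap * q = (kap - 1) * q + q)%N by rewrite mulnBl mul1n subnK // leq_pmull.
have Vsize x : (msize (V x) <= (kap * q).+1)%N.
  case: x => [[l [b /= wb]]|a] /=.
    apply: (@leq_trans (D + M.-1).+1); last by rewrite /D; nia.
    apply: msizeM_leS; last by rewrite prednK.
    exact: leq_trans (msize_mprod_le _) _.
  rewrite mpolyXn -mpolyXD msizeX ltnS mdegD mdegMn mdeg1 mul1n.
  by have := bmdeg a; rewrite kq /r -/(val a); lia.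
have [||c [x0 cx0] rel] := @mpoly_lin_dep F n J V (kap * q).+1.
- exact: Vsize.
- by rewrite card_sum card_prod card_sig.
rewrite big_sumType /= in rel.
pose Q := \sum_(a : 'X_{1..n < q - M}) c (inr a) *: 'X_[val a].
pose B := \sum_(x : K * {b | wt b}) c (inl x) *: V (inl x).
have BQ : 'X_j ^+ r.+1 * Q = - B.
  apply/eqP; rewrite -addr_eq0 addrC -[X in _ == X]rel /B /Q mulr_sumr.
  by apply/eqP; congr (_ + _); apply: eq_bigr => a _; rewrite -scalerAr.
have sB : (size (line_subst v B) <= r.+1)%N.
  rewrite rmorph_sum; apply: (leq_trans (size_sum _ _ _)); apply/bigmax_leqP.
  move=> [l [b wb]] _ /=; rewrite line_substZ; apply: leq_trans (size_scale_leq _ _) _.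
  rewrite rmorphM; apply: (leq_trans (size_polyMleq _ _)).
  have h1 := size_line_subst_mprod_le b gv.
  have h2 : (size (line_subst v (e l)) <= M)%N.
    by rewrite -(prednK M0); apply: size_line_subst_le; rewrite prednK.
  have arith x y s t : (x <= s.+1 -> y <= M -> s <= t -> (x + y).-1 <= (t + M).+1)%N.
    by lia.
  apply: (arith _ _ _ _ h1 h2).
  rewrite -(leq_pmul2l kap0) big_distrr /= mulnA [(kap * _)%N]mulnC -mulnA.
  apply: (@leq_trans ((kap - 1) * (\sum_i b i * k i))%N); last first.
    by rewrite leq_mul2l (leq_trans wb) ?leq_subr ?orbT.
  rewrite big_distrr leq_sum // => i _ /=.
  rewrite mulnCA [X in (_ <= X)%N]mulnCA leq_mul2l; apply/orP; right.
  by rewrite mulnBl mul1n -subn1 mulnBr muln1 leq_sub2l.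
(* The degrees along the lines of direction [v] separate the two halves. *)
have Q0 : Q = 0.
  apply/eqP; apply: contraT => Qn0.
  have := line_subst_growth r.+1 vj Qn0.
  by rewrite BQ rmorphN size_polyN ltnNge sB.
have cr a : c (inr a) = 0.
  have /(congr1 (mcoeff (val a))) := Q0; rewrite mcoeff0 raddf_sum (bigD1 a) //=.
  rewrite big1 ?addr0 => [|b ba]; first by rewrite mcoeffZ mcoeffX eqxx mulr1.
  by rewrite mcoeffZ mcoeffX (inj_eq val_inj) (negbTE ba) mulr0.
have B0 : B = 0 by apply/eqP; rewrite -oppr_eq0 -BQ Q0 mulr0.
case: x0 cx0 => [[l b]|a]; last by rewrite cr eqxx.
apply/negP; rewrite negbK; apply/eqP.
apply: (free_over_fibre F_unc fE f_pt e_pt (beta := fun b : {b | wt b} => val (val b))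
  (a := fun l b => c (inl (l, b)))).
  by apply: inj_comp; apply: val_inj.
by rewrite -[RHS]B0 /B pair_bigA; apply: eq_bigr => -[].
Qed.

End NoZeroAtInfinity.

Lemma no_zero_at_infinity (F : closedFieldType) (n : nat)
    (F_unc : ~ countable [set: F]%classic)
    (f : 'I_n -> {mpoly F[n]}) (k : 'I_n -> nat) (E : 'I_n -> seq F) :
    (forall i, 0 < k i)%N -> (forall i, msize (f i) = (k i).+1) ->
    (forall x, (forall i, (f i).@[x] = 0) -> forall j, x j \in E j) ->
  forall (K : finType) (pt : K -> 'I_n -> F) (e : K -> {mpoly F[n]}),
    (forall l i, (f i).@[pt l] = 0) ->
    (forall l l', ((e l).@[pt l'] == 0) = (l != l')) -> #|K| = (\prod_i k i)%N ->
  forall v : 'I_n -> F,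
    (forall i, (pihomog mdeg (k i) (f i)).@[v] = 0) -> forall j, v j = 0.
Proof.
case: n f k E => [|n] f k E; first by move=> k0 fd fE K pt e h1 h2 h3 v hv [].
exact: no_zero_at_infinity_succ.
Qed.

(** * Graded ideals and regular sequences *)

Section GradedIdeals.
Variables (F : fieldType) (n : nat).
Implicit Types (p q g : {mpoly F[n]}) (l : seq {mpoly F[n]}).

Lemma mpoly_homog_sum p : p = \sum_(d < msize p) pihomog mdeg d p.
Proof. exact: pihomog_partitionE. Qed.

Lemma pihomogMr d k p q : q \is k.-homog ->
  pihomog mdeg d (p * q) = if (k <= d)%N then pihomog mdeg (d - k) p * q else 0.
Proof.
move=> hq; rewrite {1}[p]mpoly_homog_sum mulr_suml raddf_sum /=.
have hom e : pihomog mdeg e p * q \is (e + k).-homog.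
  by apply: dhomogM => //; apply: pihomogP.
case: leqP => [kd|dk]; last first.
  by rewrite big1 // => e _; apply: pihomog_ne0 (hom e); apply/eqP; lia.
have [lt|ge] := ltnP (d - k) (msize p).
  rewrite (bigD1 (Ordinal lt)) //= big1 ?addr0 => [|e].
    by rewrite pihomog_dE //; have := hom (d - k)%N; rewrite subnK.
  by rewrite -val_eqE /= => ne; apply: pihomog_ne0 (hom e); lia.
rewrite big1 => [|e _]; last first.
  by apply: pihomog_ne0 (hom e); have := ltn_ord e; lia.
rewrite pihomogE big_seq_cond big_pred0 ?mul0r // => m.
by apply/negbTE/negP => /andP [/msize_mdeg_lt + /eqP e]; rewrite e ltnNge ge.
Qed.

Lemma ideal_gen_graded l : (forall g, g \in l -> g \is homog mdeg) ->
  forall d p, ideal_gen l p -> ideal_gen l (pihomog mdeg d p).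
Proof.
elim: l => [|g l IH] hl d p /=; first by move=> ->; rewrite raddf0.
case=> q hq; have /homogP [k gk] := hl g (mem_head _ _).
exists (if (k <= d)%N then pihomog mdeg (d - k) q else 0).
have -> : (if (k <= d)%N then pihomog mdeg (d - k) q else 0) * g = pihomog mdeg d (q * g).
  by rewrite (pihomogMr _ _ gk); case: ifP; rewrite ?mul0r.
rewrite -raddfB; apply: IH => // x xl; apply: hl.
by rewrite inE xl orbT.
Qed.

Lemma ideal_homog_components (P : {mpoly F[n]} -> Prop) p : is_ideal P ->
  (forall d, P (pihomog mdeg d p)) -> P p.
Proof. by move=> idP h; rewrite [p]mpoly_homog_sum; apply: ideal_sum. Qed.

(** The head of the list is the last element of the sequence. *)
Fixpoint regular l : Prop :=
  if l is g :: l' then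
    regular l' /\ forall p, ideal_gen l' (g * p) -> ideal_gen l' p
  else True.

Lemma regular_drop j l : regular l -> regular (drop j l).
Proof. by elim: l j => [|g l IH] [|j] //= [/IH]. Qed.

Definition homog_gt0 g := exists k, (0 < k)%N /\ g \is k.-homog.

Lemma homog_gt0_homog g : homog_gt0 g -> g \is homog mdeg.
Proof. by case=> k [_ /homogE]. Qed.

(** That [a] stays regular modulo [l] alone is where the grading enters: if [a * c]
    lies in the ideal then [c = c2 * b] modulo [l], where [c2] has lower degree and
    satisfies the same hypothesis. *)
Lemma regular_swap a b l : homog_gt0 a -> homog_gt0 b ->
    (forall g, g \in l -> homog_gt0 g) ->
  regular (a :: b :: l) -> regular (b :: a :: l).
Proof.
move=> [ka [_ ha]] [kb [kb0 hb]] hl [[rl rb] ra].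
have gr := ideal_gen_graded (fun g gl => homog_gt0_homog (hl g gl)).
have idl := ideal_gen_ideal l.
have a_reg_hom d c : c \is d.-homog -> ideal_gen l (a * c) -> ideal_gen l c.
  have [D] := ubnP d; elim: D d c => // D IH d c dD hc ac.
  have [c' hc'] : adjoin (ideal_gen l) b c by apply: ra; apply: sub_adjoin.
  have := gr d _ hc'; rewrite raddfB /= (pihomog_dE hc) (pihomogMr _ _ hb).
  case: ifP => [kbd|_]; last by rewrite subr0.
  set c2 := pihomog _ _ c'; move=> hc2.
  suff : ideal_gen l (c2 * b) by move/(ideal_eqmod idl hc2).
  apply: idealMr => //; apply: (IH (d - kb)%N); [lia | exact: pihomogP | apply: rb].
  have -> : b * (a * c2) = a * c - a * (c - c2 * b) by ring.
  by apply: idealB => //; apply: idealMl.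
have a_reg c : ideal_gen l (a * c) -> ideal_gen l c.
  move=> ac; apply: ideal_homog_components => // d.
  apply: (a_reg_hom d); first exact: pihomogP.
  have := gr (d + ka)%N _ ac.
  by rewrite mulrC (pihomogMr _ _ ha) leq_addl addnK mulrC.
split; first by split.
move=> c [c' hc].
have [c2 hc2] : adjoin (ideal_gen l) b c'.
  apply: ra; exists c; have -> : a * c' - c * b = - (b * c - c' * a) by ring.
  exact: idealN.
exists c2; apply: rb.
have -> : b * (c - c2 * a) = (b * c - c' * a) + a * (c' - c2 * b) by ring.
by apply: idealD => //; apply: idealMl.
Qed.

Lemma regular_rotate a l : (forall g, g \in a :: l -> homog_gt0 g) ->
  regular (rcons l a) -> regular (a :: l).
Proof.
elim: l => [|b l IH] // hl [rl rb].
apply: regular_swap => //; try (by apply: hl; rewrite !inE eqxx ?orbT).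
  by move=> g gl; apply: hl; rewrite !inE gl !orbT.
split; first apply: IH => //.
  by move=> g; rewrite inE => h; apply: hl; rewrite !inE orbCA h orbT.
have sub p : ideal_gen (rcons l a) p <-> ideal_gen (a :: l) p.
  by split; apply: ideal_gen_subset => g; rewrite mem_rcons.
by move=> p /sub /rb /sub.
Qed.

(** If [b * p] vanishes modulo [l], then so does [a ^+ N * p], hence [p]. *)
Lemma regular_replace a b l N : regular (a :: l) -> ideal_gen (b :: l) (a ^+ N) ->
  regular (b :: l).
Proof.
move=> [rl ra] [q hq]; split=> // p bp; have idl := ideal_gen_ideal l.
have : ideal_gen l (a ^+ N * p).
  have -> : a ^+ N * p = (a ^+ N - q * b) * p + q * (b * p) by ring.
  by apply: (idealD idl); [apply: (idealMr idl) | apply: (idealMl idl)].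
elim: N {hq} => [|N IH]; first by rewrite expr0 mul1r.
by rewrite exprS -mulrA => /ra.
Qed.

(** For homogeneous generators this says that the quotient ring has finite
    dimension. *)
Definition finite_colength l := exists N, forall m : 'X_{1..n},
  (N <= mdeg m)%N -> ideal_gen l 'X_[m].

Lemma finite_colength_at l N :
  (forall m : 'X_{1..n}, mdeg m = N -> ideal_gen l 'X_[m]) -> finite_colength l.
Proof.
move=> h; exists N => m; move: {2}(mdeg m - N)%N (erefl (mdeg m - N)%N) => e.
elim: e m => [|e IH] m; first by move=> *; apply: h; lia.
move=> me Nm; have : mdeg m != 0 by apply/eqP; lia.
rewrite mdegE sum_nat_eq0 negb_forall => /existsP [i /= mi].
have Um : (U_(i) <= m)%MM by rewrite lep1mP.
rewrite -(submK Um) mpolyXD; apply: idealMr => //.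
have := congr1 (@mdeg n) (submK Um); rewrite mdegD mdeg1.
by move=> dm; apply: IH; lia.
Qed.

Lemma finite_colength_pow l a : finite_colength l -> homog_gt0 a ->
  exists N, ideal_gen l (a ^+ N).
Proof.
move=> [N hN] [k [k0 ha]]; exists N; rewrite [_ ^+ N]mpolyE big_seq.
apply: ideal_sum => // m mp; rewrite -mul_mpolyC; apply: idealMl => //; apply: hN.
by have /dhomogP/(_ m mp) -> := dhomogMn N ha; rewrite leq_pmull.
Qed.

Lemma finite_colength_sub l l' :
  (forall g, g \in l -> ideal_gen l' g) -> finite_colength l -> finite_colength l'.
Proof. by move=> s [N h]; exists N => m /h; apply: ideal_gen_sub. Qed.

(** The elements of [x] are replaced one at a time by those of [z], from the last
    position to the first; each mixed list has finite colength, so that a power of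
    the element to be replaced lies in the ideal of the new list, as
    [regular_replace] wants. *)
Lemma regular_chain (x z : seq {mpoly F[n]}) : size x = size z ->
    (forall g, g \in x -> homog_gt0 g) -> (forall g, g \in z -> homog_gt0 g) ->
    (forall j, (j <= size z)%N -> finite_colength (drop j z ++ take j x)) ->
  regular x -> regular z.
Proof.
move=> sxz hx hz fin rx.
suff H j : (j <= size z)%N -> regular (drop (size z - j) z ++ take (size z - j) x).
  by have := H (size z) (leqnn _); rewrite subnn drop0 take0 cats0.
elim: j => [|j IH] jz; first by rewrite subn0 drop_size take_oversize ?sxz.
have {IH} := IH (ltnW jz); set i := (size z - j.+1)%N.
have -> : (size z - j = i.+1)%N by rewrite /i; lia.
have iz : (i < size z)%N by rewrite /i; lia.
rewrite (take_nth 0) ?sxz // -rcons_cat => /regular_rotate r.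
have hxi : homog_gt0 x`_i by apply: hx; rewrite mem_nth ?sxz.
have {}r : regular (x`_i :: (drop i.+1 z ++ take i x)).
  apply: r => g; rewrite inE mem_cat => /or3P [/eqP -> // | /mem_drop | /mem_take].
    exact: hz.
  exact: hx.
have [N hN] := finite_colength_pow (fin i (ltnW iz)) hxi.
rewrite (drop_nth 0) //=; apply: (regular_replace (N := N) r).
by rewrite (drop_nth 0) in hN.
Qed.

Lemma pure_powers_mem (k : 'I_n -> nat) (s : seq 'I_n) p :
  ideal_gen [seq 'X_i ^+ k i | i <- s] p <->
  (forall m, m \in msupp p -> exists2 i, i \in s & (k i <= m i)%N).
Proof.
pose P p := forall m, m \in msupp p -> exists2 i, i \in s & (k i <= m i)%N.
split; rewrite -/(P p).
  apply: ideal_gen_min => [|g /mapP [i si ->]].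
    split=> [m|p1 p2 h1 h2 m|r p1 h1 m]; first by rewrite msupp0.
      by move/msuppD_le; rewrite mem_cat => /orP [/h1|/h2].
    move=> /msuppM_le /allpairsP [[m1 m2] /= [_ /h1 [i si ki] ->]].
    by exists i => //; rewrite mnmDE (leq_trans ki) ?leq_addl.
  move=> m; rewrite mpolyXn msuppX inE => /eqP ->; exists i => //.
  by rewrite mulmnE mnm1E eqxx mul1n.
move=> h; rewrite [p]mpolyE big_seq; apply: ideal_sum => // m /h [i si ki].
rewrite -mul_mpolyC; apply: idealMl => //.
have Um : (U_(i) *+ k i <= m)%MM.
  apply/mnm_lepP => j; rewrite mulmnE mnm1E; case: eqP => [<-|//].
  by rewrite mul1n.
rewrite -(submK Um) mpolyXD -mpolyXn; apply: idealMl => //.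
by apply: ideal_gen_mem; apply: (map_f (fun i => 'X_i ^+ k i)).
Qed.

Lemma regular_pure_powers (k : 'I_n -> nat) (s : seq 'I_n) : uniq s ->
  regular [seq 'X_i ^+ k i | i <- s].
Proof.
elim: s => //= i s IH /andP [si us]; split; first exact: IH.
move=> p /pure_powers_mem h; apply/pure_powers_mem => m mp.
have [|j sj] := h (U_(i) *+ k i + m)%MM.
  by rewrite mcoeff_msupp mulrC mpolyXn mcoeffMX -mcoeff_msupp.
rewrite mnmDE mulmnE mnm1E; have [eij|_] := eqVneq i j; first by rewrite eij sj in si.
by rewrite mul0n add0n; exists j.
Qed.

End GradedIdeals.

(** * Genericity of finite colength *)

Section Openness.
Variables (F : closedFieldType) (n : nat).
Hypothesis F_unc : ~ countable [set: F]%classic.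

Lemma exists_notin (E : seq F) : exists a, a \notin E.
Proof.
apply: contrapT => /forallNP h; apply: F_unc.
have -> : [set: F]%classic = [set` E]%classic.
  by apply/seteqP; split=> // a _ /=; apply: contrapT => /negP; apply: h.
exact/finite_set_countable/finite_seq.
Qed.

(** In a degree [N] where all monomials lie in the ideal of [u], they are
    combinations of the [u i]; the same combinations of the [u i + c *: w i] are
    obtained from the monomials by the matrix [1%:M + c *: T], which is invertible
    unless [c] is a root of a polynomial with value [1] at [0]. *)
Lemma finite_colength_open r (u w : 'I_r -> {mpoly F[n]}) (k : 'I_r -> nat) :
    (forall i, u i \is (k i).-homog) -> (forall i, w i \is (k i).-homog) ->
    finite_colength (codom u) ->
  exists E : seq F, forall c, c \notin E ->
    finite_colength (codom (fun i => u i + c *: w i)).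
Proof.
move=> hu hw [N hN].
pose J : finType := {m : 'X_{1..n < N.+1} | mdeg m == N}.
pose e (i : 'I_#|J|) : 'X_{1..n} := val (val (enum_val i)).
have eN i : mdeg (e i) = N by apply/eqP; exact: (valP (enum_val i)).
have e_surj m : mdeg m = N -> exists i, e i = m.
  move=> mN; have lt : (mdeg m < N.+1)%N by rewrite mN.
  have mN' : mdeg (BMultinom lt) == N by apply/eqP.
  exists (enum_rank (exist (fun m : 'X_{1..n < N.+1} => mdeg m == N) _ mN')).
  by rewrite /e enum_rankK.
have e_inj : injective e by move=> i j /val_inj/val_inj/enum_val_inj.
have eE (p : {mpoly F[n]}) : p \is N.-homog -> p = \sum_i p@_(e i) *: 'X_[e i].
  move=> hp; apply/mpolyP => m; rewrite raddf_sum /=.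
  have [/eqP/e_surj [i <-]|mN] := boolP (mdeg m == N).
    rewrite (bigD1 i) //= big1 ?addr0 => [|j ji]; first by rewrite mcoeffZ mcoeffX eqxx mulr1.
    by rewrite mcoeffZ mcoeffX (inj_eq e_inj) (negbTE ji) mulr0.
  rewrite (dhomog_nemf_coeff hp mN) big1 // => i _; rewrite mcoeffZ mcoeffX.
  by case: eqP => [ei|_]; [rewrite -ei eN eqxx in mN | rewrite mulr0].
have /fin_all_exists [q hq] (i : 'I_#|J|) : exists q : 'I_r -> {mpoly F[n]},
    'X_[e i] = \sum_j q j * u j.
  by apply/ideal_gen_fam/hN; rewrite eN.
pose t i := pihomog mdeg N (\sum_j q i j * w j).
pose T : 'M[F]_#|J| := \matrix_(i, j) (t i)@_(e j).
pose D : {poly F} := \det (1%:M + 'X *: map_mx polyC T).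
have DE c : D.[c] = \det (1%:M + c *: T).
  rewrite -[D.[c]]/(horner_eval c D) -det_map_mx; congr (\det _).
  by apply/matrixP => i j; rewrite !mxE rmorphD rmorphM rmorph_nat /= /horner_eval hornerX hornerC.
have D0 : D != 0.
  apply: contraTneq isT => D0; have := DE 0.
  by rewrite D0 horner0 scale0r addr0 det1 => /eqP; rewrite eq_sym oner_eq0.
have [E hE] := closed_field_poly_normal D; exists E => c cE.
have Mu : 1%:M + c *: T \in unitmx.
  rewrite unitmxE unitfE -DE; apply: contra cE => /eqP Dc.
  rewrite -root_prod_XsubC -(rootZ _ _ (a := lead_coef D)) ?lead_coef_eq0 //.
  by rewrite -hE; apply/eqP.
set M := 1%:M + c *: T in Mu.
set l := codom _.
have gr d p : ideal_gen l p -> ideal_gen l (pihomog mdeg d p).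
  apply: ideal_gen_graded => g /codomP [i ->].
  by apply: (homogE (d := k i)); apply: dhomogD => //; apply: dhomogZ; apply: hw.
have yl i : ideal_gen l (\sum_j M i j *: 'X_[e j]).
  have -> : \sum_j M i j *: 'X_[e j] =
      pihomog mdeg N (\sum_j q i j * (u j + c *: w j)).
    under [in RHS]eq_bigr => j _ do rewrite mulrDr -scalerAr.
    rewrite big_split /= -hq -scaler_sumr linearD linearZ /= -/(t i).
    rewrite pihomogX /= eN eqxx [t i]eE ?pihomogP // scaler_sumr.
    rewrite [X in X + _](_ : _ = \sum_j (i == j)%:R *: 'X_[e j]); last first.
      rewrite (bigD1 i) //= eqxx scale1r big1 ?addr0 // => j.
      by rewrite eq_sym => /negbTE ->; rewrite scale0r.
    rewrite -big_split; apply: eq_bigr => j _.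
    by rewrite /M !mxE scalerDl scalerA.
  by apply: gr; apply/ideal_gen_fam; exists (q i).
apply: (@finite_colength_at _ _ _ N) => m /e_surj [i <-].
have -> : 'X_[e i] = \sum_j invmx M i j *: \sum_h M j h *: 'X_[e h] :> {mpoly F[n]}.
  under eq_bigr => j _ do rewrite scaler_sumr.
  rewrite exchange_big /= (bigD1 i) //= [X in _ + X]big1 ?addr0 => [|h hi].
    under eq_bigr => j _ do rewrite scalerA.
    have /matrixP/(_ i i) := mulVmx Mu; rewrite !mxE eqxx => h1.
    by rewrite -scaler_suml h1 scale1r.
  under eq_bigr => j _ do rewrite scalerA.
  have /matrixP/(_ i h) := mulVmx Mu; rewrite !mxE eq_sym (negbTE hi) => h0.
  by rewrite -scaler_suml h0 scale0r.
apply: ideal_sum => // j _; rewrite -mul_mpolyC; apply: idealMl => //.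
Qed.

(** The pure powers [x i] of the variables form a regular sequence. Two passes of
    [regular_chain] lead from them to [g] through [z = g + s^-1 x]: for generic [s],
    every mixture of [x] and [z] is a small perturbation of [x], up to scaling, and
    every mixture of [z] and [g] is one of [g]. *)
Lemma regular_finite_colength (g : 'I_n -> {mpoly F[n]}) (k : 'I_n -> nat) :
    (forall i, (0 < k i)%N) -> (forall i, g i \is (k i).-homog) ->
    finite_colength (codom g) ->
  regular (codom g).
Proof.
move=> k0 hg fg.
pose x i : {mpoly F[n]} := 'X_i ^+ k i.
have hx i : x i \is (k i).-homog.
  by rewrite /x mpolyXn dhomogX /= mdegMn mdeg1 mul1n.
have fx : finite_colength (codom x).
  exists (\sum_i k i).+1 => m hm; apply/pure_powers_mem => m'.
  rewrite msuppX inE => /eqP ->.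
  have [i ki|no] := pickP (fun i => (k i <= m i)%N).
    by exists i => //; rewrite mem_enum.
  exfalso; move: hm; rewrite mdegE leqNgt => /negP; apply.
  by rewrite ltnS; apply: leq_sum => i _; rewrite ltnW // ltnNge no.
have h0 i : (0 : {mpoly F[n]}) \is (k i).-homog by apply: dhomog0.
have hif (P : pred 'I_n) (a : 'I_n -> {mpoly F[n]}) :
    (forall i, a i \is (k i).-homog) ->
    forall i, (if P i then a i else 0) \is (k i).-homog.
  by move=> ha i; case: ifP.
(* The index [j] counts the positions not yet replaced. In the first pass these
   hold [x i], in the second one [z i]. *)
have /fin_all_exists [EA hA] (j : 'I_n.+1) :=
  finite_colength_open hx (hif (fun i => j <= i)%N _ hg) fx.
have /fin_all_exists [EB hB] (j : 'I_n.+1) :=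
  finite_colength_open hg (hif (fun i => i < j)%N _ hx) fg.
have [s] := exists_notin (0 :: flatten (codom EA) ++ [seq a^-1 | a <- flatten (codom EB)]).
rewrite inE negb_or mem_cat negb_or => /and3P [s0 sA sB].
have {}sA j : s \notin EA j.
  by apply: contra sA => sE; apply/flattenP; exists (EA j) => //; apply: codom_f.
have {}sB j : s^-1 \notin EB j.
  apply: contra sB => sE; rewrite -[s]invrK; apply: map_f.
  by apply/flattenP; exists (EB j) => //; apply: codom_f.
pose z i := g i + s^-1 *: x i.
have hz i : z i \is (k i).-homog.
  by apply: dhomogD => //; apply: dhomogZ; apply: hx.
have pos (a : 'I_n -> {mpoly F[n]}) : (forall i, a i \is (k i).-homog) ->
    forall p, p \in codom a -> homog_gt0 p.
  by move=> ha p /codomP [i ->]; exists (k i).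
have mix (a b : 'I_n -> {mpoly F[n]}) (j : nat) p :
    (exists i : 'I_n, p = if (i < j)%N then a i else b i) ->
    p \in drop j (codom b) ++ take j (codom a).
  case=> i ->; rewrite mem_cat; have nth_codom (c : 'I_n -> {mpoly F[n]}) : c i = (codom c)`_i.
    by rewrite (nth_map i) ?size_enum_ord // nth_ord_enum.
  case: ltnP => ij; apply/orP; [right | left].
    rewrite nth_codom -(nth_take _ ij) mem_nth // size_take size_codom card_ord.
    by case: ifP.
  rewrite nth_codom -[X in _`_X](subnKC ij) -nth_drop mem_nth //.
  by rewrite size_drop size_codom card_ord; have := ltn_ord i; lia.
have rz : regular (codom z).
  apply: (@regular_chain _ _ (codom x)); rewrite ?size_codom //.
  - exact: pos hx.
  - exact: pos hz.
  - rewrite card_ord => j jn.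
    apply: finite_colength_sub (hA (Ordinal (jn : (j < n.+1)%N)) s (sA _)).
    move=> p /codomP [i ->] /=; case: leqP => ij.
      have -> : x i + s *: g i = s *: z i.
        by rewrite /z scalerDr scalerA mulfV // scale1r addrC.
      rewrite -mul_mpolyC; apply: idealMl => //; apply: ideal_gen_mem.
      by apply: mix; exists i; rewrite ltnNge ij.
    rewrite scaler0 addr0; apply: ideal_gen_mem; apply: mix.
    by exists i; rewrite ij.
  - exact: regular_pure_powers (enum_uniq _).
apply: (@regular_chain _ _ (codom z)); rewrite ?size_codom //.
- exact: pos hz.
- exact: pos hg.
rewrite card_ord => j jn.
apply: finite_colength_sub (hB (Ordinal (jn : (j < n.+1)%N)) s^-1 (sB _)).
move=> p /codomP [i ->] /=; apply: ideal_gen_mem; apply: mix.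
by exists i; case: ltnP => ij //; rewrite scaler0 addr0.
Qed.

End Openness.

(** * The Hilbert function of a regular sequence *)

Section QuotientBasis.
Variables (F : fieldType) (V : lmodType F).
Implicit Types (P U : V -> Prop) (I J : finType).

Definition is_subspace P : Prop :=
  [/\ P 0, forall u v, P u -> P v -> P (u + v) & forall c v, P v -> P (c *: v)].

(** A basis of [U] modulo [P]; families over finite types make the union of two
    bases a family over a sum type. *)
Definition quotient_basis P U I (b : I -> V) : Prop :=
  [/\ forall i, U (b i),
      forall a : I -> F, P (\sum_i a i *: b i) -> forall i, a i = 0
    & forall v, U v -> exists a : I -> F, P (v - \sum_i a i *: b i)].

Lemma subspace_sum P I (v : I -> V) : is_subspace P -> (forall i, P (v i)) ->
  P (\sum_i v i).
Proof. by case=> P0 PD _ h; apply: big_ind. Qed.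

Lemma quotient_basis_leq P U I J (b : I -> V) (c : J -> V) : is_subspace P ->
  quotient_basis P U b -> quotient_basis P U c -> (#|I| <= #|J|)%N.
Proof.
move=> subP [bU bI _] [cU _ cS]; have [P0 PD PZ] := subP.
have /fin_all_exists [a ha] i := cS _ (bU i).
pose M : 'M[F]_(#|I|, #|J|) := \matrix_(r, s) a (enum_val r) (enum_val s).
suff /eqP <- : row_free M by apply: rank_leq_col.
rewrite -kermx_eq0; apply/rowV0P => u /sub_kermxP uM.
apply/rowP => r; rewrite mxE -[r]enum_valK.
apply: (bI (fun i => u 0 (enum_rank i))).
have -> : \sum_i u 0 (enum_rank i) *: b i =
    \sum_i u 0 (enum_rank i) *: (b i - \sum_j a i j *: c j).
  under [RHS]eq_bigr => i _ do rewrite scalerBr scaler_sumr.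
  rewrite sumrB -[LHS]subr0; congr (_ - _); rewrite exchange_big big1 //= => j _.
  under eq_bigr => i _ do rewrite scalerA.
  have /rowP/(_ (enum_rank j)) := uM; rewrite !mxE => h.
  rewrite -scaler_suml -[X in X *: _](_ : 0 = _) ?scale0r // -[LHS]h.
  rewrite [RHS](reindex (@enum_val _ I)) /=; last first.
    by exists enum_rank => i _; rewrite ?enum_valK ?enum_rankK.
  by apply: eq_bigr => i _; rewrite enum_valK mxE enum_rankK.
by apply: subspace_sum => // i; apply: PZ.
Qed.

Lemma quotient_basis_card P U I J (b : I -> V) (c : J -> V) : is_subspace P ->
  quotient_basis P U b -> quotient_basis P U c -> #|I| = #|J|.
Proof.
move=> sP hb hc; apply/eqP; rewrite eqn_leq.
by rewrite (quotient_basis_leq sP hb hc) (quotient_basis_leq sP hc hb).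
Qed.

End QuotientBasis.

Section HilbertFunction.
Variables (F : fieldType) (n : nat).
Implicit Types (l : seq {mpoly F[n]}).
Local Notation forms t := (fun p : {mpoly F[n]} => p \is t.-homog).

Lemma ideal_gen_subspace l : is_subspace (ideal_gen l).
Proof.
have idl := ideal_gen_ideal l.
split; [exact: ideal0 | by move=> u v; apply: idealD |].
by move=> c v; rewrite -mul_mpolyC; apply: idealMl.
Qed.

Lemma quotient_basis_low g l k t (I : finType) (b : I -> {mpoly F[n]}) :
    (forall g, g \in l -> g \is homog mdeg) -> g \is k.-homog -> (t < k)%N ->
  quotient_basis (ideal_gen (g :: l)) (forms t) b -> quotient_basis (ideal_gen l) (forms t) b.
Proof.
move=> hl hg tk [bU bI bS]; split=> // [a|p hp].
  by move=> h; apply: bI; apply: sub_adjoin.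
have [a [q hq]] := bS p hp; exists a.
have := ideal_gen_graded hl t hq.
rewrite raddfB /= (pihomogMr _ _ hg) leqNgt tk subr0 pihomog_dE //.
by apply: rpredB => //; apply: rpred_sum => i _; apply: dhomogZ.
Qed.

(** The exact sequence
    [0 -> (A / l)_t -> (A / l)_(k + t) -> (A / (g, l))_(k + t) -> 0], whose first map
    is the multiplication by [g]. *)
Lemma quotient_basis_step g l k t (I J : finType) (b : I -> {mpoly F[n]})
    (c : J -> {mpoly F[n]}) :
    (forall g, g \in l -> g \is homog mdeg) -> g \is k.-homog ->
    regular (g :: l) ->
    quotient_basis (ideal_gen l) (forms t) b ->
    quotient_basis (ideal_gen (g :: l)) (forms (k + t)%N) c ->
  quotient_basis (ideal_gen l) (forms (k + t)%N)
    (fun x : I + J => match x with inl i => g * b i | inr j => c j end).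
Proof.
move=> hl hg [rl rg] [bU bI bS] [cU cI cS]; have idl := ideal_gen_ideal l.
have sumE (a : I + J -> F) :
    \sum_x a x *: (match x with inl i => g * b i | inr j => c j end) =
    g * (\sum_i a (inl i) *: b i) + \sum_j a (inr j) *: c j.
  rewrite big_sumType /= mulr_sumr; congr (_ + _); apply: eq_bigr => i _.
  by rewrite scalerAr.
split.
- by case=> [i|j] //; apply: dhomogM => //; apply: bU.
- move=> a; rewrite sumE => h.
  have aJ : forall j, a (inr j) = 0.
    apply: cI; exists (- (\sum_i a (inl i) *: b i)).
    by rewrite mulNr opprK mulrC addrC.
  have aI : forall i, a (inl i) = 0.
    apply: bI; apply: rg; move: h; rewrite [X in _ + X]big1 ?addr0 // => j _.
    by rewrite aJ scale0r.
  by case.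
- move=> p hp; have [a [q hq]] := cS p hp.
  have hs : \sum_j a j *: c j \is (k + t).-homog.
    by apply: rpred_sum => j _; apply: dhomogZ; apply: cU.
  have := ideal_gen_graded hl (k + t) hq.
  rewrite raddfB /= (pihomogMr _ _ hg) leq_addr addKn pihomog_dE; last exact: rpredB.
  set q' := pihomog _ _ q => hq'.
  have [a' ha'] := bS q' (pihomogP _ _ _).
  exists (fun x => match x with inl i => a' i | inr j => a j end); rewrite sumE.
  rewrite opprD addrCA addrC.
  have -> : p - \sum_j a j *: c j - g * (\sum_i a' i *: b i) =
     (p - \sum_j a j *: c j - q' * g) + (q' - \sum_i a' i *: b i) * g by ring.
  by apply: idealD => //; apply: idealMr.
Qed.

Lemma quotient_basis_monomials L t : (t <= L)%N ->
  quotient_basis (ideal_gen [::]) (forms t)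
    (fun h : {h : {ffun 'I_n -> 'I_L.+1} | (\sum_i h i == t)%N} =>
       'X_[[multinom (val h i : nat) | i < n]]).
Proof.
move=> tL; pose e (h : {h : {ffun 'I_n -> 'I_L.+1} | (\sum_i h i == t)%N}) :=
  [multinom (val h i : nat) | i < n].
have eN h : mdeg (e h) = t.
  rewrite mdegE -[RHS](eqP (valP h)); apply: eq_bigr => i _.
  by rewrite mnmE.
have e_inj : injective e.
  move=> h h' /mnmP ee; apply/val_inj/ffunP => i; apply: val_inj.
  by have := ee i; rewrite !mnmE.
have e_surj m : mdeg m = t -> exists h, e h = m.
  move=> mt; have lt i : (m i < L.+1)%N.
    by rewrite ltnS (leq_trans (mnm_le_mdeg m i)) // mt.
  pose h0 : {ffun 'I_n -> 'I_L.+1} := [ffun i => Ordinal (lt i)].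
  have ht : (\sum_i h0 i == t)%N.
    by rewrite -mt mdegE; apply/eqP/eq_bigr => i _; rewrite ffunE.
  exists (exist (fun h : {ffun 'I_n -> 'I_L.+1} => (\sum_i h i == t)%N) h0 ht).
  by apply/mnmP => i; rewrite mnmE /= ffunE.
have coefE (a : _ -> F) h : (\sum_h' a h' *: 'X_[e h'])@_(e h) = a h.
  rewrite raddf_sum (bigD1 h) //= big1 ?addr0 => [|h' hh'].
    by rewrite mcoeffZ mcoeffX eqxx mulr1.
  by rewrite mcoeffZ mcoeffX (inj_eq e_inj) (negbTE hh') mulr0.
split.
- by move=> h; rewrite dhomogX /= -/(e h) eN.
- by move=> a /= a0 h; rewrite -(coefE a h) a0 mcoeff0.
- move=> p hp; exists (fun h => p@_(e h)); apply/eqP; rewrite subr_eq0.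
  apply/eqP/mpolyP => m; have [/eqP/e_surj [h <-]|mt] := boolP (mdeg m == t).
    by rewrite coefE.
  rewrite (dhomog_nemf_coeff hp mt) raddf_sum big1 // => h _ /=.
  rewrite mcoeffZ mcoeffX -/(e h); case: eqP => [eh|_]; last by rewrite mulr0.
  by rewrite -eh eN eqxx in mt.
Qed.

(** Expand the [n]-th power of the truncated geometric series. *)
Lemma card_monomials L t :
  (#|{: {h : {ffun 'I_n -> 'I_L.+1} | (\sum_i h i == t)%N}}|)%:Z =
  ((\sum_(l < L.+1) 'X^l) ^+ n : {poly int})`_t.
Proof.
rewrite -[n in RHS]card_ord -prodr_const bigA_distr_bigA /= coef_sum.
have -> : #|{: {h : {ffun 'I_n -> 'I_L.+1} | (\sum_i h i == t)%N}}| =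
    (\sum_(h : {ffun 'I_n -> 'I_L.+1}) (t == \sum_i h i))%N.
  rewrite card_sig -sum1_card big_mkcond; apply: eq_bigr => h _.
  by rewrite eq_sym inE; case: eqP.
rewrite -natz natr_sum; apply: eq_bigr => h _.
by rewrite prodrXr coefXn.
Qed.

(** The dimensions modulo the whole sequence are given, and the induction proceeds
    towards shorter sequences: the exact sequences build bases modulo [r] from bases
    modulo [(k, g) :: r], and multiply the generating series by the inverse of
    [1 - 'X^k]. At the empty sequence the number of monomials is known. *)
Lemma hilbert_function_regular (r : seq (nat * {mpoly F[n]})) (c : nat -> nat) L :
    (forall x, x \in r -> (0 < x.1)%N /\ x.2 \is (x.1).-homog) ->
    regular [seq x.2 | x <- r] ->
    (forall t, exists (I : finType) (b : I -> {mpoly F[n]}), #|I| = c t /\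
       quotient_basis (ideal_gen [seq x.2 | x <- r]) (forms t) b) ->
  forall t, (t <= L)%N ->
    (c t)%:Z = (\prod_(x <- r) (1 - 'X^(x.1)) * (\sum_(l < L.+1) 'X^l) ^+ n : {poly int})`_t.
Proof.
elim: r c => [|[k g] r IH] c hr /= reg hc t tL.
  have [I [b [<- hb]]] := hc t; rewrite big_nil mul1r -card_monomials.
  congr (_%:Z); apply: quotient_basis_card (quotient_basis_monomials tL) => //.
    exact: (ideal_gen_subspace [::]).
  exact: hb.
have [/= k0 hg] := hr _ (mem_head _ _).
have hr' x : x \in r -> (0 < x.1)%N /\ x.2 \is (x.1).-homog.
  by move=> xr; apply: hr; rewrite inE xr orbT.
have hl g' : g' \in [seq x.2 | x <- r] -> g' \is homog mdeg.
  by move=> /mapP [x /hr' [_ /homogE h] ->].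
have sub := ideal_gen_subspace [seq x.2 | x <- r].
(* Bases modulo [r], by induction on the degree since [k] is positive. *)
have ex t' : exists d, exists (I : finType) (b : I -> {mpoly F[n]}), #|I| = d /\
    quotient_basis (ideal_gen [seq x.2 | x <- r]) (forms t') b.
  have [D] := ubnP t'; elim: D t' => // D IHD t' tD.
  have [J [b [_ hb]]] := hc t'.
  have [tk|kt] := ltnP t' k.
    by exists #|J|, J, b; split=> //; apply: (quotient_basis_low hl hg tk hb).
  have [|d [I [b' [_ hb']]]] := IHD (t' - k)%N; first by lia.
  rewrite -(subnKC kt) in hb *.
  have st := quotient_basis_step hl hg reg hb' hb.
  by eexists; eexists; eexists; split; last exact: st.
have [c' hc'] := choice ex.
rewrite big_cons -mulrA mulrBl mul1r coefB coefXnM.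
have H := IH c' hr' reg.1 hc'.
case: ltnP => [tk|kt].
  rewrite subr0 -H //; congr (_%:Z).
  have [I [b [<- hb]]] := hc t; have [J [b' [<- hb']]] := hc' t.
  by apply: (quotient_basis_card sub _ hb'); apply: (quotient_basis_low hl hg tk hb).
rewrite -!H //; last by rewrite (leq_trans (leq_subr _ _)).
have [I [b [<- hb]]] := hc t; have [J [b' [<- hb']]] := hc' t.
have [J' [b'' [<- hb'']]] := hc' (t - k)%N.
apply/eqP; rewrite eq_sym subr_eq -PoszD; apply/eqP; congr Posz.
rewrite addnC -card_sum; apply: (quotient_basis_card sub hb').
rewrite -(subnKC kt) in hb *.
exact: quotient_basis_step hl hg reg hb'' hb.
Qed.

End HilbertFunction.

(** * Linear spans *)

Section LinearSpans.
Variables (F : fieldType) (V : lmodType F).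
Implicit Types (b e : seq V) (U : V -> Prop).

Definition in_span b (v : V) : Prop :=
  exists a : 'I_(size b) -> F, v = \sum_(i < size b) a i *: b`_i.

Lemma in_span_subspace b : is_subspace (in_span b).
Proof.
split.
- by exists (fun=> 0); rewrite big1 // => i _; rewrite scale0r.
- move=> u v [a ->] [c ->]; exists (fun i => a i + c i).
  by rewrite -big_split; apply: eq_bigr => i _; rewrite scalerDl.
- move=> c v [a ->]; exists (fun i => c * a i).
  by rewrite scaler_sumr; apply: eq_bigr => i _; rewrite scalerA.
Qed.

Lemma in_span_mem b v : v \in b -> in_span b v.
Proof.
move=> vb; have lt : (index v b < size b)%N by rewrite index_mem.
exists (fun i => (i == Ordinal lt)%:R); rewrite (bigD1 (Ordinal lt)) //= eqxx scale1r.
rewrite nth_index // big1 ?addr0 // => i /negbTE ->; by rewrite scale0r.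
Qed.

Lemma in_span_cons x b v : in_span b v -> in_span (x :: b) v.
Proof.
case=> a ->; apply: subspace_sum (in_span_subspace _) _ => i.
have [_ _ +] := in_span_subspace (x :: b); apply; apply: in_span_mem.
by rewrite inE mem_nth ?orbT.
Qed.

Lemma lin_indep_cons x b : lin_indep b -> ~ in_span b x -> lin_indep (x :: b).
Proof.
move=> hb xb a; rewrite big_ord_recl /= => h.
have a0 : a ord0 = 0.
  apply: contra_notP xb => /eqP a0; exists (fun i => - (a ord0)^-1 * a (lift ord0 i)).
  under eq_bigr => i _ do rewrite -scalerA.
  have hS : \sum_(i < size b) a (lift ord0 i) *: b`_i = - (a ord0 *: x).
    by apply/eqP; rewrite -addr_eq0 addrC; apply/eqP; exact: h.
  by rewrite -scaler_sumr hS scalerN scaleNr opprK scalerA mulVf // scale1r.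
move: h; rewrite a0 scale0r add0r => h i.
by case: (unliftP ord0 i) => [j ->|-> //]; apply: (hb (fun i => a (lift ord0 i))).
Qed.

Lemma has_dim_of_spanning U e : is_subspace U ->
    (forall v, v \in e -> U v) -> (forall v, U v -> in_span e v) ->
  exists2 d, has_dim U d & (d <= size e)%N.
Proof.
move=> subU eU Ue.
have [b [bs be bi eb]] : exists b, [/\ (size b <= size e)%N, {subset b <= e},
    lin_indep b & forall v, v \in e -> in_span b v].
  elim: e {eU Ue} => [|x e [b [bs be bi eb]]].
    by exists [::]; split=> // a _ [].
  have [xb|xb] := pselect (in_span b x).
    exists b; split=> //; first exact: leqW.
      by move=> v /be ve; rewrite inE ve orbT.
    by move=> v; rewrite inE => /predU1P [->|/eb].
  exists (x :: b); split=> //; last 1 first.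
  - by move=> v; rewrite inE => /predU1P [->|/eb]; [apply: in_span_mem; apply: mem_head | apply: in_span_cons].
  - by move=> v; rewrite !inE => /predU1P [->|/be ->]; rewrite ?eqxx ?orbT.
  - exact: lin_indep_cons.
exists (size b) => //; exists b; split=> // [v /be /eU //|v /Ue [a ->]].
apply: subspace_sum (in_span_subspace _) _ => i.
by have [_ _ +] := in_span_subspace b; apply; apply: eb; rewrite mem_nth.
Qed.

End LinearSpans.

(** * Unselected monomials *)

Section Unselected.
Variables (F : fieldType) (n s : nat) (phi : nat -> 'X_{1..n}).
Hypothesis phi_list : graded_listing phi.
Variables (k : 'I_s -> nat) (f : 'I_s -> {mpoly F[n]}) (t : nat).
Variable C : selection phi k f t.

Local Notation g := (top_form k f).
Local Notation items := (sel_items C).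
Local Notation idx := (sel_idx C).
Local Notation col := (@sel_col _ _ _ _ _ _ _ C).

Lemma top_form_homog i : g i \is (k i).-homog.
Proof. exact: pihomogP. Qed.

Definition homog_coef (q : 'I_s -> {mpoly F[n]}) i : {mpoly F[n]} :=
  if (k i <= t)%N then pihomog mdeg (t - k i) (q i) else 0.

Lemma pihomog_top_sum q :
  pihomog mdeg t (\sum_i q i * g i) = \sum_i homog_coef q i * g i.
Proof.
rewrite raddf_sum; apply: eq_bigr => i _ /=; rewrite (pihomogMr _ _ (top_form_homog i)).
by rewrite /homog_coef; case: ifP; rewrite ?mul0r.
Qed.

Lemma elementary_item_part v : elementary_item k f t v -> top_ideal_part k f t v.
Proof.
case=> i [m [mt ->]]; split.
  by rewrite -mt; apply: dhomogM; [rewrite dhomogX | apply: top_form_homog].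
by apply: idealMl; [apply: fam_ideal_ideal | apply: fam_ideal_mem].
Qed.

(** Otherwise the selected items could be extended by [v]. *)
Lemma elementary_item_span v : elementary_item k f t v -> in_span items v.
Proof.
move=> hv; have [_ indep maxi] := sel_itemsP C.
have [vi|vi] := boolP (v \in items); first exact: in_span_mem.
by apply: contrapT => nv; apply: (maxi v hv vi); apply: lin_indep_cons.
Qed.

Lemma top_ideal_part_span v : top_ideal_part k f t v -> in_span items v.
Proof.
have [s0 sD sZ] := in_span_subspace items.
case=> hv [q hq]; rewrite -(pihomog_dE hv) hq pihomog_top_sum.
apply: subspace_sum (in_span_subspace _) _ => i; rewrite /homog_coef.
case: leqP => [kt|_]; last by rewrite mul0r.
rewrite pihomogE mulr_suml big_seq_cond.
apply: (big_ind (in_span items)) => // m /andP [_ /eqP mt].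
rewrite -scalerAl; apply: sZ; apply: elementary_item_span; exists i, m.
by split=> //; move: mt => /= ->; rewrite subnK.
Qed.

Lemma sel_items_part v : v \in items -> top_ideal_part k f t v.
Proof. by have [h _ _] := sel_itemsP C; move/h; apply: elementary_item_part. Qed.

(** Both numbers are the dimension of the degree [t] part of the ideal of top forms. *)
Lemma size_sel_items : size items = sel_dim C.
Proof.
apply: has_dim_uniq (sel_dimP C); exists items; have [_ indep _] := sel_itemsP C.
by split=> //; [apply: sel_items_part | apply: top_ideal_part_span].
Qed.

Local Notation mon l := (phi (nth 0%N idx l)).
Local Notation M := (colsub col (item_matrix phi items idx)).

Lemma selM_row_free : row_free M.
Proof.
have := sel_colP C; rewrite /row_free mxrank_tr => /eqP ->.
by rewrite size_sel_items.
Qed.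

Lemma selM_row_full : row_full M.
Proof. by have := sel_colP C; rewrite /row_free /row_full mxrank_tr. Qed.

Lemma mon_inj (l l' : 'I_(size idx)) : mon l = mon l' -> l = l'.
Proof.
move=> /(bij_inj phi_list.1) /eqP; rewrite nth_uniq //; first by move/eqP/val_inj.
exact: sorted_uniq ltn_trans ltnn _ (sel_idx_sorted C).
Qed.

Lemma mdeg_mon (l : 'I_(size idx)) : mdeg (mon l) = t.
Proof. by apply/eqP; rewrite -(sel_idxP C) mem_nth. Qed.

Lemma mon_surj m : mdeg m = t -> exists l : 'I_(size idx), mon l = m.
Proof.
have [psi psiK phiK] := phi_list.1 => mt.
have hm : psi m \in idx by rewrite (sel_idxP C) phiK mt.
have lt : (index (psi m) idx < size idx)%N by rewrite index_mem.
by exists (Ordinal lt); rewrite /= nth_index.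
Qed.

Definition unsel : finType := {l : 'I_(size idx) | l \in [predC codom col]}.
Definition unsel_mon (l : unsel) : {mpoly F[n]} := 'X_[mon (val l)].

Lemma card_unsel : #|unsel| = size (unselected C).
Proof. by rewrite size_map -cardE card_sig; apply: eq_card => l; rewrite !inE. Qed.

Lemma combination_coef (x : 'I_(size items) -> F) (l : 'I_(size idx)) :
  (\sum_r x r *: items`_r)@_(mon l) = \sum_r x r * item_matrix phi items idx r l.
Proof. by rewrite raddf_sum; apply: eq_bigr => r _ /=; rewrite mcoeffZ mxE. Qed.

Lemma unsel_sum_coef (a : unsel -> F) (l : unsel) :
  (\sum_l' a l' *: unsel_mon l')@_(mon (val l)) = a l.
Proof.
rewrite raddf_sum (bigD1 l) //= big1 ?addr0 => [|l' ll'].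
  by rewrite mcoeffZ mcoeffX eqxx mulr1.
rewrite mcoeffZ mcoeffX; case: eqP => [/mon_inj/val_inj e|_]; last by rewrite mulr0.
by rewrite e eqxx in ll'.
Qed.

Lemma unsel_sum_coef0 (a : unsel -> F) c :
  (\sum_l' a l' *: unsel_mon l')@_(mon (col c)) = 0.
Proof.
rewrite raddf_sum big1 // => l _ /=.
rewrite mcoeffZ mcoeffX; case: eqP => [/mon_inj e|_]; last by rewrite mulr0.
by have := valP l; rewrite inE /= e codom_f.
Qed.

(** The matrix of the selected rows and columns is invertible: an element of the
    ideal is determined by its coefficients at the selected monomials, and these can
    be prescribed. *)
Lemma unselected_quotient_basis :
  quotient_basis (fam_ideal g) (fun p => p \is t.-homog) unsel_mon.
Proof.
split.
- by move=> l; rewrite dhomogX /= mdeg_mon.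
- move=> a ha; have hom : \sum_l a l *: unsel_mon l \is t.-homog.
    by apply: rpred_sum => l _; apply: dhomogZ; rewrite dhomogX /= mdeg_mon.
  have [x hx] := top_ideal_part_span (conj hom ha).
  have x0 : \row_r x r = 0.
    apply: (row_free_inj selM_row_free); rewrite mul0mx; apply/rowP => c.
    rewrite !mxE -[RHS](unsel_sum_coef0 a c) hx combination_coef.
    by apply: eq_bigr => r _; rewrite !mxE.
  move=> l; rewrite -(unsel_sum_coef a l) hx big1 ?mcoeff0 // => r _.
  by have /rowP/(_ r) := x0; rewrite !mxE => ->; rewrite scale0r.
- move=> p hp.
  have [x hx] : exists x : 'rV_(size items), \row_c p@_(mon (col c)) = x *m M.
    by have /submxP := submx_full (\row_c p@_(mon (col c))) selM_row_full.
  pose w := \sum_r x 0 r *: items`_r.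
  have wpart : top_ideal_part k f t w.
    split; first by apply: rpred_sum => r _; apply: dhomogZ; case: (sel_items_part (mem_nth 0 (ltn_ord r))).
    apply: ideal_sum; first exact: fam_ideal_ideal.
    move=> r _; rewrite -mul_mpolyC; apply: idealMl; first exact: fam_ideal_ideal.
    by case: (sel_items_part (mem_nth 0 (ltn_ord r))).
  exists (fun l : unsel => (p - w)@_(mon (val l))).
  suff <- : w = p - \sum_(l : unsel) (p - w)@_(mon (val l)) *: unsel_mon l by exact: wpart.2.
  apply/eqP; rewrite eq_sym subr_eq addrC -subr_eq; apply/eqP/mpolyP => m.
  have [/eqP/mon_surj [l <-]|mt] := boolP (mdeg m == t); last first.
    have hh : p - w \is t.-homog by apply: rpredB => //; case: wpart.
    rewrite (dhomog_nemf_coeff hh mt) (dhomog_nemf_coeff _ mt) //.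
    by apply: rpred_sum => l _; apply: dhomogZ; rewrite dhomogX /= mdeg_mon.
  have [/codomP [c ->]|lc] := boolP (l \in codom col).
    rewrite unsel_sum_coef0 mcoeffB combination_coef.
    have /rowP/(_ c) := hx; rewrite !mxE => ->; apply/eqP; rewrite subr_eq0; apply/eqP.
    by apply: eq_bigr => r _; rewrite !mxE.
  have lP : l \in [predC codom col] by rewrite inE.
  by rewrite -[l]/(val (exist (fun l => l \in [predC codom col]) l lP)) unsel_sum_coef.
Qed.

End Unselected.

(** * Representation and restriction *)

Section Representation.
Variables (F : fieldType) (n s : nat) (phi : nat -> 'X_{1..n}).
Hypothesis phi_list : graded_listing phi.
Variables (k : 'I_s -> nat) (f : 'I_s -> {mpoly F[n]}).
Hypothesis f_deg : forall i, msize (f i) = (k i).+1.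

Local Notation g := (top_form k f).

Lemma mcoeff_pihomog d (p : {mpoly F[n]}) m :
  (pihomog mdeg d p)@_m = if mdeg m == d then p@_m else 0.
Proof.
case: eqP => [md|/eqP md]; last by apply: dhomog_nemf_coeff md; apply: pihomogP.
rewrite [X in _ = X@_m]mpoly_homog_sum [RHS]raddf_sum /=.
have other e : e != d -> (pihomog mdeg e p)@_m = 0.
  by move=> ed; apply: dhomog_nemf_coeff (pihomogP _ _ _) _; rewrite /= md eq_sym.
have [dp|pd] := ltnP d (msize p).
  rewrite [RHS](bigD1 (Ordinal dp)) //= [X in _ + X]big1 ?addr0 // => e.
  by rewrite -val_eqE /=; apply: other.
rewrite [RHS]big1 => [|e _]; last by apply: other; rewrite ltn_eqF // (leq_trans _ pd).
rewrite pihomogE big_seq_cond big_pred0 ?mcoeff0 // => m'.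
by apply/negbTE/negP => /andP [/msize_mdeg_lt + /eqP e]; rewrite e ltnNge pd.
Qed.

Lemma msize_leP (p : {mpoly F[n]}) d :
  (forall m, (d <= mdeg m)%N -> p@_m = 0) -> (msize p <= d)%N.
Proof.
move=> h; rewrite msizeE; apply/bigmax_leqP_seq => m mp _; rewrite ltnNge.
by apply: contraL mp => /h pm; rewrite mcoeff_msupp pm eqxx.
Qed.

Lemma msize_sub_top (p : {mpoly F[n]}) d : (msize p <= d.+1)%N ->
  (msize (p - pihomog mdeg d p) <= d)%N.
Proof.
move=> pd; apply: msize_leP => m dm; rewrite mcoeffB mcoeff_pihomog.
case: eqP => [_|/eqP md]; first by rewrite subrr.
rewrite subr0 memN_msupp_eq0 // msize_mdeg_ge //; apply: leq_trans pd _.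
by rewrite ltn_neqAle eq_sym md.
Qed.

Lemma msize_homog (p : {mpoly F[n]}) d : p != 0 -> p \is d.-homog -> msize p = d.+1.
Proof.
move=> p0 hp; rewrite mpolySpred //; congr _.+1.
exact: dhomog_uniq p0 (dhomog_msize hp) hp.
Qed.

(** Write [p] in the basis of unselected monomials modulo the top forms, and keep
    only the part of the multipliers [q] of the right degree. *)
Lemma reduce_form t (C : selection phi k f t) (p : {mpoly F[n]}) : p \is t.-homog ->
  exists (a : nat -> F) (q : 'I_s -> {mpoly F[n]}),
    (forall i, q i != 0 -> (k i <= t)%N /\ q i \is (t - k i).-homog) /\
    p = \sum_(j <- unselected C) a j *: 'X_[phi j] + \sum_i q i * g i.
Proof.
move=> hp; have [monU _ span] := unselected_quotient_basis phi_list C.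
have [a [q hq]] := span p hp; set w := \sum_i _ in hq.
have hw : w \is t.-homog by apply: rpred_sum => l _; apply: dhomogZ; apply: monU.
(* The coefficient of an unselected monomial in [w] is its coefficient in [a]. *)
exists (fun j => w@_(phi j)), (homog_coef k t q); split.
  move=> i; rewrite /homog_coef; case: ifP => [ki _|]; last by rewrite eqxx.
  by split=> //; apply: pihomogP.
rewrite -pihomog_top_sum -hq pihomog_dE; last exact: rpredB.
rewrite -[LHS](subrK w) addrC; congr (_ + _).
rewrite big_image /= (big_sub (fun l => l \in [predC codom (@sel_col _ _ _ _ _ _ _ C)])).
apply: eq_bigr => l _; rewrite -[X in X *: _](unsel_sum_coef phi_list a).
by [].
Qed.

Variable T : forall t, selection phi k f t.

(** Reduce the form of highest degree and replace the top forms by the polynomials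
    [f j] themselves; the error has lower degree. *)
Lemma representation m (p : {mpoly F[n]}) : (msize p <= m.+1)%N ->
  exists (a : nat -> nat -> F) (c : nat -> 'I_s -> {mpoly F[n]}),
    p = \sum_(t < m.+1)
          (\sum_(j <- unselected (T t)) a t j *: 'X_[phi j] + \sum_(j < s) c t j * f j)
    /\ (forall t j, (t <= m)%N -> c t j != 0 -> msize (c t j * f j) = t.+1).
Proof.
have step t (r : {mpoly F[n]}) : (msize r <= t.+1)%N ->
  exists (a : nat -> F) (q : 'I_s -> {mpoly F[n]}),
    (forall j, q j != 0 -> msize (q j * f j) = t.+1) /\
    (msize (r - (\sum_(j <- unselected (T t)) a j *: 'X_[phi j] + \sum_j q j * f j)) <= t)%N.
  move=> rt; have [a [q [hq hr]]] := reduce_form (T t) (pihomogP mdeg t r).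
  exists a, q; split=> [j qj|].
    have [kt hqj] := hq j qj.
    rewrite msizeM // -?msize_poly_eq0 ?f_deg // (msize_homog qj hqj).
    by rewrite addSn /= addnS subnK.
  set u := \sum_(j <- _) _ in hr *.
  have -> : r - (u + \sum_j q j * f j) =
      (r - pihomog mdeg t r) - \sum_j q j * (f j - g j).
    under [X in _ = _ - X]eq_bigr => j _ do rewrite mulrBr.
    by rewrite sumrB hr; ring.
  apply: leq_trans (msizeD_le _ _) _; rewrite geq_max msize_sub_top //= msizeN.
  apply: leq_trans (msize_sum _ _ _) _; apply/bigmax_leqP => j _.
  have [->|qj] := eqVneq (q j) 0; first by rewrite mul0r msize0.
  have [kt hqj] := hq j qj.
  have fg : (msize (f j - g j) <= k j)%N by apply: msize_sub_top; rewrite f_deg.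
  have [->|fg0] := eqVneq (f j - g j) 0; first by rewrite mulr0 msize0.
  rewrite msizeM // (msize_homog qj hqj) addSn /=.
  by rewrite -[X in (_ <= X)%N](subnK kt) leq_add2l.
elim: m p => [|m IH] p pm; have [a [q [hq hr]]] := step _ _ pm.
  exists (fun=> a), (fun=> q); split; last by move=> t j; rewrite leqn0 => /eqP ->; apply: hq.
  rewrite big_ord1; apply/eqP; rewrite -subr_eq0 -msize_poly_eq0 -leqn0.
  exact: hr.
have [a' [c' [hp hc]]] := IH _ hr.
exists (fun t => if t == m.+1 then a else a' t), (fun t => if t == m.+1 then q else c' t).
split; last first.
  move=> t j; rewrite leq_eqVlt; case: eqP => [-> _|_ /= tm]; first exact: hq.
  exact: hc.
rewrite big_ord_recr /= eqxx -[LHS](subrK (\sum_(j <- unselected (T m.+1)) a j *: 'X_[phi j] +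
  \sum_j q j * f j)) [X in X + _ = _]hp; congr (_ + _).
by apply: eq_bigr => t _; rewrite ltn_eqF.
Qed.

(** On the zero set only the unselected monomials of the representation survive. *)
Lemma restrictions_dim m :
  exists2 d, has_dim (restrictions m (S := zero_set f)) d
    & (d <= \sum_(t < m.+1) size (unselected (T t)))%N.
Proof.
pose S := zero_set f.
pose res (p : {mpoly F[n]}) : {x | x \in S} -> F^o := restriction (S := S) p.
pose e := flatten [seq [seq res 'X_[phi j] | j <- unselected (T (t : 'I_m.+1))] | t <- index_enum _].
have -> : (\sum_(t < m.+1) size (unselected (T t)) = size e)%N.
  rewrite size_flatten /shape -map_comp sumnE big_map.
  by apply: eq_bigr => t _; rewrite /= size_map.
have resD p q : res (p + q) = res p + res q by apply/funext => x; rewrite /res /restriction mevalD.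
have resZ c p : res (c *: p) = c *: res p by apply/funext => x; rewrite /res /restriction mevalZ.
have res0 : res 0 = 0 by apply/funext => x; rewrite /res /restriction meval0.
have phi_mem (t : 'I_m.+1) j : j \in unselected (T t) -> mdeg (phi j) = t.
  by move=> /mapP [l _ ->]; apply: mdeg_mon.
apply: has_dim_of_spanning.
- split.
  + by exists 0 => //; rewrite msize0.
  + move=> u v [p hp ->] [q hq ->]; exists (p + q); last by rewrite -resD.
    by apply: leq_trans (msizeD_le _ _) _; rewrite geq_max hp.
  + move=> c v [p hp ->]; exists (c *: p); last by rewrite -resZ.
    exact: leq_trans (msizeZ_le _ _) hp.
- move=> v /flattenP [l /mapP [t _ ->] /mapP [j jt ->]]; exists 'X_[phi j] => //.
  by rewrite msizeX (phi_mem _ _ jt) ltnS -ltnS.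
- move=> v [p /representation [a [c [hp _]]] ->].
  have [s0 sD sZ] := in_span_subspace e.
  have -> : restriction p = res (\sum_(t < m.+1) \sum_(j <- unselected (T t)) a t j *: 'X_[phi j]).
    apply/funext => x; rewrite /res /restriction {1}hp !raddf_sum /=.
    apply: eq_bigr => t _; rewrite mevalD.
    suff -> : (\sum_(j < s) c t j * f j).@[sval x] = 0 by rewrite addr0.
    rewrite raddf_sum big1 // => j _ /=.
    by rewrite mevalM; have /forallP/(_ j)/eqP -> := valP x; rewrite mulr0.
  rewrite (big_morph res resD res0); apply: subspace_sum (in_span_subspace e) _ => t.
  rewrite (big_morph res resD res0) big_seq; apply: big_ind => // j jt.
  rewrite resZ; apply: sZ; apply: in_span_mem; apply/flattenP.
  exists [seq res 'X_[phi j] | j <- unselected (T t)].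
    by apply/mapP; exists t => //; rewrite mem_index_enum.
  exact: (map_f (fun j => res 'X_[phi j])).
Qed.

End Representation.

(** * Sufficient intersection *)

Section SufficientIntersection.
Variables (F : closedFieldType).
Hypothesis F_unc : ~ countable [set: F]%classic.

(** A product of linear forms, each of which separates the [l]-th point from one of
    the others. *)
Lemma separating_polynomials n (pts : seq {ffun 'I_n -> F}) : uniq pts ->
  exists e : 'I_(size pts) -> {mpoly F[n]}, forall l l' : 'I_(size pts),
    ((e l).@[pts`_l'] == 0) = (l != l').
Proof.
move=> upts.
have ex (l l' : 'I_(size pts)) : exists q : {mpoly F[n]},
    l' != l -> q.@[pts`_l'] = 0 /\ q.@[pts`_l] != 0.
  have [->|ne] := eqVneq l' l; first by exists 0.
  have /existsP [c hc] : [exists c, pts`_l' c != pts`_l c].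
    apply: contraNT ne; rewrite negb_exists => /forallP h.
    have : pts`_l' = pts`_l by apply/ffunP => c; apply/eqP; have := h c; rewrite negbK.
    by move/eqP; rewrite nth_uniq.
  exists ('X_c - (pts`_l' c)%:MP) => _; rewrite !mevalB !mevalXU !mevalC subrr.
  by rewrite subr_eq0 eq_sym.
have /fin_all_exists [q hq] l := fin_all_exists (ex l).
exists (fun l => \prod_(l' | l' != l) q l l') => l l'.
rewrite rmorph_prod /=; have [<-|ll'] := eqVneq l l'.
  by apply/negbTE/prodf_neq0 => j jl; have [] := hq l j jl.
apply/eqP; rewrite (bigD1 l') 1?eq_sym //=.
by have [-> _] := hq l l' (contra_neq (@esym _ _ _) ll'); rewrite mul0r.
Qed.

(** Complete [f] by the auxiliary polynomials [f'] to [n] polynomials [h]. Their top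
    forms have no common zero but the origin, hence finite colength, so they form a
    regular sequence; those of [f'] come last in the sequence and can be dropped. *)
Lemma regular_top_forms n s (k : 'I_s -> nat) (f : 'I_s -> {mpoly F[n]}) :
    (0 < s)%N -> (s <= n)%N -> (forall i, 0 < k i)%N ->
    (forall i, msize (f i) = (k i).+1) -> sufficiently_intersect k f ->
  regular (codom (top_form k f)).
Proof.
move=> s0 sn k0 f_deg [k' [f' [hf' [pts [upts sz mem_pts]]]]].
pose L := codom f' ++ codom f; pose kL := codom k' ++ codom k.
have sL : size L = n by rewrite size_cat !size_codom !card_ord subnK.
have skL : size kL = n by rewrite size_cat !size_codom !card_ord subnK.
pose h (i : 'I_n) : {mpoly F[n]} := L`_i; pose kh (i : 'I_n) : nat := nth 0%N kL i.
have nthc (T : Type) (x0 : T) r (c : 'I_r -> T) (i : 'I_r) : nth x0 (codom c) i = c i.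
  by rewrite (nth_map i) ?size_enum_ord // nth_ord_enum.
have cases (Q : nat -> {mpoly F[n]} -> Prop) :
    (forall j, Q (k' j) (f' j)) -> (forall j, Q (k j) (f j)) -> forall i, Q (kh i) (h i).
  move=> h1 h2 i; rewrite /kh /h !nth_cat !size_codom !card_ord; case: ltnP => ir.
    by rewrite -[nat_of_ord i]/(nat_of_ord (Ordinal ir)) !nthc.
  have lt : (i - (n - s) < s)%N by have := ltn_ord i; lia.
  by rewrite -[(i - (n - s))%N]/(nat_of_ord (Ordinal lt)) !nthc.
have kh0 : forall i, (0 < kh i)%N.
  by apply: (cases (fun k _ => 0 < k)%N) => // j; case: (hf' j).
have h_deg : forall i, msize (h i) = (kh i).+1.
  by apply: (cases (fun k f => msize f = k.+1)) => // j; case: (hf' j).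
have zeros x : x \in pts <-> (forall i, (h i).@[x] = 0).
  rewrite mem_pts; split.
    move=> /andP [/forallP zf /forallP zf'].
    by apply: (cases (fun _ f => f.@[x] = 0)) => j; apply/eqP; [apply: zf' | apply: zf].
  move=> zh; have zL p : p \in L -> p.@[x] == 0.
    move=> pL; have lt := pL; rewrite -index_mem sL in lt.
    by have := zh (Ordinal lt); rewrite /h /= nth_index // => ->.
  by apply/andP; split; apply/forallP => j; apply: zL; rewrite mem_cat codom_f ?orbT.
have hE x : (forall i, (h i).@[x] = 0) -> forall j, x j \in [seq y j | y : {ffun 'I_n -> F} <- pts].
  move=> hx j; have -> : x j = [ffun j => x j] j by rewrite ffunE.
  apply: (map_f (fun y : {ffun 'I_n -> F} => y j)); apply/zeros => i.
  by rewrite -[RHS](hx i); apply: meval_eq => c; rewrite ffunE.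
have card_pts : #|'I_(size pts)| = (\prod_i kh i)%N.
  have -> : (\prod_i kh i = \prod_(x <- kL) x)%N by rewrite (big_nth 0%N) skL big_mkord.
  by rewrite card_ord sz mulnC big_cat !big_image.
have [e he] := separating_polynomials upts.
have h_pt l i : (h i).@[pts`_(l : 'I_(size pts))] = 0.
  by have /zeros := mem_nth 0 (ltn_ord l); apply.
have top0 (v : 'I_n -> F) : (forall i, (top_form kh h i).@[v] = 0) -> forall j, v j = 0.
  by move=> hv; apply: (no_zero_at_infinity F_unc kh0 h_deg hE h_pt he card_pts).
have top_homog i : top_form kh h i \is (kh i).-homog by apply: pihomogP.
(* The lowest form of an element of a graded ideal stays in it, so the isolation
   of the origin puts powers of the variables themselves into the ideal. *)
have fin : finite_colength (codom (top_form kh h)).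
  have [|N hN] := @finite_zeros_isolated F n F_unc _ (top_form kh h) (fun=> [:: 0]).
    by move=> x /top0 x0 j; rewrite x0 inE.
  have hp (j : 'I_n) : ideal_gen (codom (top_form kh h)) ('X_j ^+ N).
    have [u [u1 /ideal_gen_fam hu]] := hN j.
    have hom g : g \in codom (top_form kh h) -> g \is homog mdeg.
      by move=> /codomP [i ->]; apply: homogE (top_homog i).
    have XN : ('X_j ^+ N : {mpoly F[n]}) \is N.-homog.
      by rewrite mpolyXn dhomogX /= mdegMn mdeg1 mul1n.
    have := ideal_gen_graded hom N hu; rewrite (pihomogMr _ _ XN) leqnn subnn.
    suff -> : pihomog mdeg 0 u = 1 by rewrite mul1r.
    apply/mpolyP => m; rewrite mcoeff_pihomog mcoeff1 mdeg_eq0.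
    by case: eqP => [->|].
  exists (n * N).+1 => m hm.
  have [j Nj|no] := pickP (fun j => (N <= m j)%N).
    have Um : (U_(j) *+ N <= m)%MM.
      apply/mnm_lepP => i; rewrite mulmnE mnm1E; case: eqP => [<-|//].
      by rewrite mul1n.
    rewrite -(submK Um) mpolyXD -mpolyXn; exact: idealMl.
  exfalso; move: hm; rewrite mdegE ltnNge => /negP; apply.
  have -> : (n * N = \sum_(j < n) N)%N by rewrite sum_nat_const card_ord.
  by apply: leq_sum => i _; rewrite ltnW // ltnNge no.
have := regular_finite_colength F_unc kh0 top_homog fin.
move/(regular_drop (n - s)).
suff -> : drop (n - s) (codom (top_form kh h)) = codom (top_form k f) by [].
apply: (@eq_from_nth _ 0).
  by rewrite size_drop !size_codom !card_ord subKn.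
rewrite size_drop size_codom card_ord subKn // => i lt.
have lt' : ((n - s) + i < n)%N by lia.
rewrite nth_drop (nthc _ 0 _ (top_form k f) (Ordinal lt)).
rewrite (nthc _ 0 _ (top_form kh h) (Ordinal lt')) /top_form /h /kh /=.
rewrite !nth_cat !size_codom !card_ord ltnNge leq_addr /= addKn.
by rewrite (nthc _ 0 _ f (Ordinal lt)) (nthc _ 0%N _ k (Ordinal lt)).
Qed.

End SufficientIntersection.

(** * Uncountability, and the conclusion *)

(** A countable set has Lebesgue measure zero, and the unit interval does not. *)
Lemma complex_uncountable (R : realType) : ~ countable [set: complex R]%classic.
Proof.
move=> cC.
have cR : countable [set: R]%classic.
  apply: card_le_trans cC; apply: card_le_trans (card_image_le (@complex.Re R) setT).
  by apply: subset_card_le => x _; exists (Complex x 0).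
have := lebesgue_measure.lebesgue_measure_itv `[(0 : R), 1].
rewrite lebesgue_measure.countable_lebesgue_measure0; last first.
  by apply: sub_countable cR; apply: subset_card_le.
rewrite /= constructive_ereal.lte_fin ltr01 -constructive_ereal.EFinB subr0 => -[].
by move/eqP; rewrite eq_sym oner_eq0.
Qed.

Lemma size_unselected (F : closedFieldType) (n s : nat)
    (F_unc : ~ countable [set: F]%classic)
    (k : 'I_s -> nat) (f : 'I_s -> {mpoly F[n]})
    (phi : nat -> 'X_{1..n}) (phi_list : graded_listing phi)
    (T : forall t : nat, selection phi k f t) :
    (0 < s)%N -> (s <= n)%N -> (forall i, 0 < k i)%N ->
    (forall i, msize (f i) = (k i).+1) -> sufficiently_intersect k f ->
  forall t, (size (unselected (T t)))%:Z = hilb_coef n k t.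
Proof.
move=> s0 sn k0 f_deg suff t.
have reg := regular_top_forms F_unc s0 sn k0 f_deg suff.
pose r := [seq (k i, top_form k f i) | i <- enum 'I_s].
have rE : [seq x.2 | x <- r] = codom (top_form k f).
  by rewrite -map_comp.
have := @hilbert_function_regular F n r (fun t => size (unselected (T t))) t.
rewrite rE /hilb_coef big_map big_enum /=; apply => //.
  by move=> _ /mapP [i _ ->]; split=> //=; apply: top_form_homog.
move=> d; have [h1 h2 h3] := unselected_quotient_basis phi_list (T d).
exists (unsel (T d)), (@unsel_mon _ _ _ _ _ _ _ (T d)); split; first exact: card_unsel.
split=> //.
  by move=> a /ideal_gen_fam; apply: h2.
by move=> v /h3 [a ha]; exists a; apply/ideal_gen_fam.
Qed.

Local Open Scope complex_scope.

Theorem theorem2p3 (R : realType) (n s : nat) (s_gt0 : (1 <= s)%N)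
    (s_le_n : (s <= n)%N)
    (k : 'I_s -> nat) (f : 'I_s -> {mpoly R[i][n]})
    (f_deg : forall i, msize (f i) = (k i).+1)
    (f_red : forall i, without_multiple_factors (f i))
    (f_suff : sufficiently_intersect k f)
    (phi : nat -> 'X_{1..n}) (phi_list : graded_listing phi)
    (T : forall t : nat, selection phi k f t)
    (m : nat) :
  (forall p : {mpoly R[i][n]}, (msize p <= m.+1)%N ->
     exists (a : nat -> nat -> R[i]) (c : nat -> 'I_s -> {mpoly R[i][n]}),
       p = \sum_(t < m.+1)
             (\sum_(j <- unselected (T t)) a t j *: 'X_[phi j]
              + \sum_(j < s) c t j * f j)
       /\ (forall t j, (t <= m)%N -> c t j != 0 -> msize (c t j * f j) = t.+1))
  /\
  (exists2 d : nat,
     has_dim (restrictions m (S := zero_set f)) d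
     & d%:Z <= \sum_(j < m.+1) hilb_coef n k j).
Proof.
split=> [p pm|]; first exact: representation.
have [k0|[i ki]] : (forall i, 0 < k i)%N \/ exists i, k i = 0%N.
  have [i /eqP ki|no] := pickP (fun i => k i == 0%N); first by right; exists i.
  by left => i; rewrite lt0n no.
  have [d hd dle] := restrictions_dim phi_list f_deg T m.
  exists d => //; have := size_unselected (@complex_uncountable R) phi_list T s_gt0 s_le_n k0 f_deg f_suff.
  move=> hs; under eq_bigr => j _ do rewrite -hs.
  by rewrite -(big_morph Posz PoszD (erefl _)) lez_nat.
(* If some [f i] is a nonzero constant, the zero set is empty and the product
   of the [1 - 'X^(k i)] vanishes. *)
exists 0%N; last first.
  rewrite sumr_ge0 // => j _.
  by rewrite /hilb_coef (bigD1 i) //= ki expr0 subrr !mul0r coef0.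
exists [::]; split=> //; first by move=> a _ [].
move=> h [p _ ->]; exists (fun=> 0); rewrite big_ord0; apply/funext => x.
have /forallP/(_ i)/eqP := valP x.
have := f_deg i; rewrite ki => /eqP/msize_poly1P [c c0 ->]; rewrite mevalC => e.
by rewrite e eqxx in c0.
Qed.
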